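(* Let $X$ and $Y$ be two Banach spaces and $M>1$. Assume that $f:X\to Y$ and $g:Y\to X$ are continuous with $Lip_\infty(f)\le 1$, $Lip_\infty(g)<M$, and that there exists a constant $C\ge 0$ such that $$\forall x\in X\ \ \|(g\circ f)(x)-x\|\le C\quad\text{and}\quad \forall y\in Y\ \ \|(f\circ g)(y)-y\|\le C.$$ Then for any $\varepsilon\in(0,1)$, there exists an equivalent norm $|\ |$ on $Y$ such that $$\frac{1}{1+\varepsilon}\|\ \|_Y\le |\ |\le M\|\ \|_Y\quad\text{and}\quad \forall t\in [0,1]\ \ \ \overline{\theta}_{|\ |}(t)\ge \overline{\theta}_X\Big(\frac{t}{48\,M^2}\Big)-\varepsilon.$$
   Context: For a map $f$ between Banach spaces, $Lip_s(f)=\sup\{\|f(x)-f(x')\|/\|x-x'\| : \|x-x'\|\ge s\}$ for $s>0$, and $Lip_\infty(f)=\inf_{s>0}Lip_s(f)$. For a Banach space $Z$ with dual norm on $Z^*$, $t>0$ and $z^*\in S_{Z^*}$ (unit sphere of $Z^*$): $\overline{\theta}_Z(z^*,t)=\sup_{E}\inf_{w^*\in S_{E^\perp}}(\|z^*+tw^*\|-1)$, where $E$ runs through all finite dimensional subspaces of $Z$, $E^\perp\subset Z^*$ is the annihilator of $E$ and $S_{E^\perp}$ its unit sphere; and $\overline{\theta}_Z(t)=\inf_{z^*\in S_{Z^*}}\overline{\theta}_Z(z^*,t)$ (with value $0$ at $t=0$). $\overline{\theta}_{|\ |}$ denotes this modulus for the Banach space $(Y,|\ |)$, computed with the dual norm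 of $|\ |$ on $Y^*$. *)

(* Defs.v *)
From HB Require Import structures.
From mathcomp Require Import all_boot all_order all_algebra.
From mathcomp Require Import all_classical all_reals all_analysis.
Export numFieldNormedType.Exports.

Set Implicit Arguments.
Unset Strict Implicit.
Unset Printing Implicit Defensive.

Import Order.TTheory GRing.Theory Num.Theory.

Local Open Scope classical_set_scope.
Local Open Scope ring_scope.

Section Lipschitz.
Context {R : realType} {X Y : normedModType R}.

(* The supremum is taken in the extended reals, so it is [-oo] when no two
   points are at distance at least [s], i.e. when [X] is the zero space. *)
Definition Lip_s (f : X -> Y) (s : R) : \bar R :=
  ereal_sup [set (`|f p.1 - f p.2| / `|p.1 - p.2|)%:E
            | p in [set p : X * X | s <= `|p.1 - p.2|]].

Definition Lip_oo (f : X -> Y) : \bar R :=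
  ereal_inf [set Lip_s f s | s in [set s : R | 0 < s]].

End Lipschitz.

(* A normed space is given here as a vector space [V] with a norm function [N],
   so that several norms on the same space can be considered. *)
Section Norms.
Context {R : realType} {V : lmodType R}.
Implicit Types (N : V -> R) (phi : V -> R) (E : set V).

Definition is_norm N : Prop :=
  [/\ forall v, N v = 0 -> v = 0,
      forall u v, N (u + v) <= N u + N v
    & forall a v, N (a *: v) = `|a| * N v].

Definition equivalent_norms N N' : Prop :=
  exists a b : R, [/\ 0 < a, 0 < b & forall v, a * N v <= N' v <= b * N v].

(* the dual of (V, N): continuity is expressed as boundedness *)
Definition dual N : set (V -> R) :=
  [set phi | scalar phi /\ exists k : R, forall v, `|phi v| <= k * N v].

Definition dual_norm N phi : \bar R :=
  ereal_sup [set `|phi v|%:E | v in [set v | N v <= 1]].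

Definition dual_sphere N : set (V -> R) :=
  [set phi | dual N phi /\ dual_norm N phi = 1%E].

Definition finite_dim_subspace E : Prop :=
  exists n (e : 'I_n -> V),
    E = [set v | exists c : 'I_n -> R, v = \sum_(i < n) c i *: e i].

Definition annihilator N E : set (V -> R) :=
  [set phi | dual N phi /\ forall v, E v -> phi v = 0].

Definition theta_at N (zs : V -> R) (t : R) : \bar R :=
  ereal_sup
    [set ereal_inf
           [set (dual_norm N (fun v => zs v + t * ws v)%R - 1)%E
           | ws in dual_sphere N `&` annihilator N E]
    | E in finite_dim_subspace].

(* The infimum of the empty set is [+oo]; hence [theta N t = +oo] for t != 0
   when V is finite dimensional. The value at 0 is 0 in every case. *)
Definition theta N (t : R) : \bar R :=
  if t == 0 then 0%E
  else ereal_inf [set theta_at N zs t | zs in dual_sphere N].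

End Norms.

(* Main.v *)
Require Import Defs.
From HB Require Import structures.
From mathcomp Require Import all_boot all_order all_algebra.
From mathcomp Require Import all_classical all_reals all_analysis.
From mathcomp Require Import zify ring lra.

Set Implicit Arguments.
Unset Strict Implicit.
Unset Printing Implicit Defensive.

Import Order.TTheory GRing.Theory Num.Theory.

(** The theorem is proved by renorming Y through the slopes of f at large scales.

    Write theta for the modulus of X, and for d > 0 consider the slopes
    (f p - f q) / |p - q| with |p - q| >= d.  As Lip_oo f <= 1, for d large they
    lie in (1 + eps) times the unit ball; as g is an M-Lipschitz inverse of f up to
    bounded errors, the supremum of a functional phi over the slopes at scale d,
    a seminorm a_d(phi), is at least |phi| / M.  Average the seminorms a_d over the
    scales d = s, 4 s, ..., 4^(n-1) s.  The new norm on Y is the polar of this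
    average, and its dual norm is the average itself ([opnorm_new_norm]).

    Let zs be of norm one for that dual norm, and let p, q nearly attain
    a_(4d)(zs).  With v = (p - q) / 2 and x0 the midpoint, two facts about z in X
    are used.

    - Smoothness ([primal_smoothness]): if theta(tau) > beta then |v + z| and
      |v - z| are at most (1 + beta + delta) |v| as soon as |z| <= (beta/tau) |v|
      and z is small on finitely many functionals.  This dualizes the definition
      of theta through weak* compactness of the dual ball and the existence of
      norming functionals ([hahn_banach], proved with minimal sublinear
      functionals).

    - The Gorelik principle ([gorelik]): a weak neighbourhood of 0 meets the image
      of a suitable finite-dimensional compact set under every continuous
      perturbation of the identity.  Applied to a |-> g (y + f (x0 + a)) - x0, it
      gives z as above such that f (x0 + z) is, up to a bounded error and a point
      of a compact set, a prescribed vector y whose norm is comparable with |v|.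

    If ws vanishes on a finite net of the compact set and y is chosen with ws y
    negative, then
      a_d(zs + t ws) |v - z| + a_d(zs) |v + z|
        >= (zs + t ws)(f p - f (x0 + z)) + zs (f (x0 + z) - f q)
        >= zs (f p - f q) - t ws y - (bounded error),
    and the first term on the right is about 2 |v| a_(4d)(zs).  So
    2 a_(4d)(zs) - a_d(zs) appears in place of a_d(zs); in the average over the
    scales this telescopes up to O(1/n) ([average_estimate]).  The gain -t ws y is
    a multiple of beta |v| which outweighs the losses due to the factors
    1 + beta + delta.

    The Gorelik principle rests on the Brouwer fixed point theorem
    ([simplex_fixpoint]), which is deduced from a combinatorial lemma of Scarf on
    families of linear orders ([scarf]); these orders take the place of a
    triangulation, and the parity argument is the one of Sperner. *)

(** * Scarf's lemma *)

Section Collision.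
Variables (T U : finType) (h : T -> U) (A : {set T}).

Definition colliding : {set T} :=
  [set x in A | [exists y in A, (y != x) && (h y == h x)]].

Lemma imset_setD1_colliding x :
  x \in A -> (h @: (A :\ x) == h @: A) = (x \in colliding).
Proof.
move=> xA; rewrite inE xA /=; apply/eqP/existsP => [hA|[y /and3P[yA yx /eqP hyx]]].
  have /imsetP[y + hxy] : h x \in h @: (A :\ x) by rewrite hA imset_f.
  by rewrite !inE => /andP[yx yA]; exists y; rewrite yA yx hxy eqxx.
apply/eqP; rewrite finset.eqEsubset imsetS ?subD1set //=; apply/fintype.subsetP.
move=> _ /imsetP[z zA ->]; have [->|zx] := eqVneq z x; last by rewrite imset_f // !inE zx.
by rewrite -hyx imset_f // !inE yx.
Qed.

(** Used twice below: for the colours of the vertices of a cell, and for the map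
    sending an order to the vertex that minimizes it.  As the image is
    smaller by one, exactly one fibre is not a singleton, and it has two points. *)
Lemma card_colliding : #|h @: A|.+1 = #|A| -> #|colliding| = 2.
Proof.
move=> hA.
have /imset_injP ninj : ~~ (#|h @: A| == #|A|) by rewrite -hA neq_ltn ltnSn.
have [i [j [iA jA ij hij]]] : exists i j, [/\ i \in A, j \in A, i != j & h i = h j].
  have [/existsP[i /existsP[j /and4P[iA jA ij /eqP hij]]]|/existsPn none] :=
      boolP [exists i, [exists j, [&& i \in A, j \in A, i != j & h i == h j]]].
    by exists i, j.
  case: ninj => i j iA jA hij; apply/eqP; have /existsPn/(_ j) := none i.
  by rewrite iA jA hij eqxx andbT negbK.
have iK : i \in colliding.
  by rewrite inE iA; apply/existsP; exists j; rewrite jA eq_sym ij hij eqxx.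
have inj : {in A :\ i &, injective h}.
  apply/imset_injP; move: iK; rewrite -imset_setD1_colliding // => /eqP ->.
  by rewrite -eqSS hA (cardsD1 i A) iA.
have -> : colliding = [set i; j]; last by rewrite cards2 ij.
apply/setP => k; rewrite !inE; apply/andP/orP => [[kA /existsP[l /and3P[lA lk /eqP hlk]]]|].
  have [ki|ki] := eqVneq k i; first by left.
  have [li|li] := eqVneq l i; last by move: lk; rewrite (inj l k) ?eqxx // !inE ?li ?ki.
  by right; apply/eqP/inj; rewrite ?inE ?ki ?kA ?jA 1?eq_sym ?ij //= -hlk li.
case=> /eqP ->; split=> //; apply/existsP; [exists j|exists i].
  by rewrite jA eq_sym ij hij eqxx.
by rewrite iA ij hij eqxx.
Qed.

End Collision.

Section Scarf.
Variables (X I : finType) (rk : I -> X -> nat) (c : X -> I) (i0 : I).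
Hypothesis rk_inj : forall i, injective (rk i).
Hypothesis X_gt0 : 0 < #|X|.

(** Dominant sets play the role of simplices in a triangulation, with [C] the set of
    barycentric coordinates that do not vanish.  The minimum of the empty set counts
    as infinite: the empty set is dominant as soon as [C] is inhabited, and serves
    as the entrance of the parity argument. *)
Definition dominant (s : {set X}) (C : {set I}) : bool :=
  [forall y, [exists i in C, [forall x in s, rk i y <= rk i x]]].

Lemma dominantP (s : {set X}) (C : {set I}) :
  reflect (forall y, exists2 i, i \in C & forall x, x \in s -> rk i y <= rk i x)
          (dominant s C).
Proof.
apply: (iffP forallP) => dom y.
  by have /existsP[i /andP[iC /forall_inP]] := dom y; exists i.
have [i iC ile] := dom y; apply/existsP; exists i; rewrite iC /=.
exact/forall_inP.
Qed.

Lemma dominantS (s t : {set X}) (C D : {set I}) :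
  s \subset t -> C \subset D -> dominant t C -> dominant s D.
Proof.
move=> /fintype.subsetP st /fintype.subsetP CD /dominantP dom; apply/dominantP => y.
by have [i /CD iD ile] := dom y; exists i => // x /st; exact: ile.
Qed.

(** In a dominant pair every vertex is the minimum for some index, so there are at
    most as many vertices as indices.  Cells are the full pairs, and
    doors are the facets through which a path of cells may pass: one leaves a door by
    adding a vertex or by dropping an index. *)
Definition is_cell (p : {set X} * {set I}) : bool :=
  dominant p.1 p.2 && (#|p.1| == #|p.2|).

Definition is_door (p : {set X} * {set I}) : bool :=
  [&& dominant p.1 p.2, i0 \in p.2, #|p.1|.+1 == #|p.2| & c @: p.1 == p.2 :\ i0].

Definition incident (d p : {set X} * {set I}) : bool :=
  ((d.2 == p.2) && (d.1 \subset p.1)) || ((d.1 == p.1) && (p.2 \subset d.2)).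

Lemma incident_card_eq1 d p : is_door d -> is_cell p -> incident d p ->
  (exists2 y, y \notin d.1 & p = (y |: d.1, d.2)) \/
  (exists2 k, k \in d.2 & p = (d.1, d.2 :\ k)).
Proof.
case: d => s C; case: p => t D /and4P[/= dsC i0C /eqP sC cs] /andP[/= dtD /eqP tD].
rewrite /incident /= => /orP[/andP[/eqP CD st]|/andP[/eqP e DC]]; last first.
  right; subst t; have /properP[_ [k kC kD]] : D \proper C.
    by rewrite properEcard DC -tD -sC ltnSn.
  exists k => //; congr (_, _); apply/eqP; rewrite eqEcard -tD.
  rewrite subsetD1 DC kD /=.
  by move: sC; rewrite (cardsD1 k) kC => -[->].
left; subst D; have /properP[_ [y yt ys]] : s \proper t.
  by rewrite properEcard st tD -sC ltnSn.
exists y => //; congr (_, _); apply/eqP; rewrite eq_sym eqEcard.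
rewrite finset.subUset finset.sub1set yt st /=.
by rewrite tD -sC cardsU1 ys.
Qed.

Section DoorCells.
Variables (s : {set X}) (C : {set I}) (x1 : X).
Hypotheses (x1s : x1 \in s) (dsC : dominant s C) (sC : #|s|.+1 = #|C|).

Let m (k : I) : X := [arg min_(x < x1 in s) rk k x].

Let m_in k : m k \in s.
Proof. by rewrite /m; case: arg_minnP. Qed.

Let m_min k x : x \in s -> rk k (m k) <= rk k x.
Proof. by rewrite /m; case: arg_minnP => // y _ + xs; apply. Qed.

Let m_surj : m @: C = s.
Proof.
apply/eqP; rewrite finset.eqEsubset; apply/andP; split.
  by apply/fintype.subsetP => _ /imsetP[k _ ->].
apply/fintype.subsetP => x xs; have /dominantP/(_ x)[k kC kle] := dsC.
apply/imsetP; exists k => //; apply: (@rk_inj k); apply/eqP.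
by rewrite eqn_leq kle ?m_in // m_min.
Qed.

Let K := colliding m C.

Let Z (k : I) : {set X} := [set y | [forall l in C :\ k, rk l (m l) < rk l y]].

Let ZP k y : reflect (forall l, l \in C -> l != k -> rk l (m l) < rk l y) (y \in Z k).
Proof.
rewrite inE; apply: (iffP forall_inP) => H l; last by rewrite !inE => /andP[]; auto.
by move=> lC lk; apply: H; rewrite !inE lk.
Qed.

Let Z_le k y : k \in C -> y \in Z k -> rk k y <= rk k (m k).
Proof.
move=> kC /ZP yZ; have /dominantP/(_ y)[l lC lle] := dsC.
have [<-|lk] := eqVneq l k; first exact: lle.
by have := yZ _ lC lk; rewrite ltnNge lle.
Qed.

Let notdom k : (Z k == finset.set0) = dominant s (C :\ k).
Proof.
apply/eqP/dominantP => [Z0 y|dom].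
  have : y \notin Z k by rewrite Z0 inE.
  rewrite inE negb_forall => /existsP[l]; rewrite negb_imply -leqNgt => /andP[lC lle].
  by exists l => // x xs; apply: leq_trans lle (m_min _ xs).
apply/setP => y; rewrite finset.in_set0; apply/negP => /ZP yZ; have [l + lle] := dom y.
by rewrite !inE => /andP[lk lC]; have := yZ l lC lk; rewrite ltnNge lle.
Qed.

Let ZmK k : k \in C -> (m k \in Z k) = (k \notin K).
Proof.
move=> kC; rewrite [k \in K]inE kC negb_exists /=; apply/ZP/forallP => [H l|H l lC lk].
  apply/negP => /and3P[lC lk]; have := H l lC lk.
  by case: eqP => // ->; rewrite ltnn.
have := H l; rewrite lC lk /= => mlk; rewrite ltn_neqAle m_min // andbT.
by apply: contra mlk => /eqP/rk_inj/eqP.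
Qed.

(** The points of [Z k] obstruct dropping [k]; the highest of them for [k] is the
    only vertex that can be added with [k] as its index. *)
Let yk (k : I) : X :=
  odflt x1 [pick y in Z k | [forall z in Z k, rk k z <= rk k y]].

Let ykP k : Z k != finset.set0 -> yk k \in Z k /\ forall y, y \in Z k -> rk k y <= rk k (yk k).
Proof.
case/set0Pn => z zZ; rewrite /yk; case: pickP => [y /andP[yZ /forall_inP]|none] //=.
have := none [arg max_(y > z in Z k) rk k y]; case: arg_maxnP => // y yZ yle.
by rewrite yZ /=; move/negbT/negP; case; apply/forall_inP.
Qed.

Let cell_of (k : I) : {set X} * {set I} :=
  if Z k == finset.set0 then (s, C :\ k) else (yk k |: s, C).

Let yk_new k : k \in K -> Z k != finset.set0 ->
  rk k (yk k) < rk k (m k) /\ yk k \notin s.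
Proof.
move=> kK Z0; have [yZ yle] := ykP Z0.
have kC : k \in C by move: kK; rewrite inE => /andP[].
have lt : rk k (yk k) < rk k (m k).
  rewrite ltn_neqAle Z_le // andbT; apply/eqP => /rk_inj e.
  by move: yZ; rewrite e ZmK // kK.
by split=> //; apply: contraL lt => ys; rewrite -leqNgt m_min.
Qed.

Let cell_ofP k : k \in K -> is_cell (cell_of k).
Proof.
move=> kK; have kC : k \in C by move: kK; rewrite inE => /andP[].
rewrite /cell_of; have [Z0|Z0] := eqVneq (Z k) finset.set0; rewrite /is_cell /=.
  by rewrite -notdom Z0 eqxx /= -eqSS sC (cardsD1 k) kC.
have [yZ yle] := ykP Z0; have [ylt ys] := yk_new kK Z0.
rewrite cardsU1 ys -sC eqxx andbT; apply/dominantP => z.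
have [zZ|] := boolP (z \in Z k).
  exists k => // x; rewrite !inE => /orP[/eqP -> |xs]; first exact: yle.
  by apply: (leq_trans (yle _ zZ)); apply: (leq_trans (ltnW ylt)); exact: m_min.
rewrite inE negb_forall => /existsP[l]; rewrite negb_imply -leqNgt !inE.
move=> /andP[/andP[lk lC] lle]; exists l => // x; rewrite !inE => /orP[/eqP ->|xs].
  by move/ZP: yZ => /(_ l lC lk) /ltnW; exact: leq_trans.
exact: leq_trans lle (m_min _ xs).
Qed.

Let cell_of_incident k : k \in K -> incident (s, C) (cell_of k).
Proof.
by rewrite /cell_of /incident; case: ifP => _ /= kK;
  rewrite ?eqxx ?subD1set ?finset.subsetUr ?orbT.
Qed.

Let cell_of_inj : {in K &, injective cell_of}.
Proof.
move=> k l kK lK; have kC : k \in C by move: kK; rewrite inE => /andP[].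
have lC : l \in C by move: lK; rewrite inE => /andP[].
have D1 i : i \in C -> C :\ i != C by move=> iC; apply/eqP/setP => /(_ i); rewrite !inE eqxx iC.
rewrite /cell_of; have [Zk|Zk] := eqVneq (Z k) finset.set0; have [Zl|Zl] := eqVneq (Z l) finset.set0.
- by case=> /setP/(_ k); rewrite !inE eqxx kC !andbT /= => /esym/negbFE/eqP.
- by case=> _ e; move: (D1 k kC); rewrite e eqxx.
- by case=> _ e; move: (D1 l lC); rewrite -e eqxx.
case=> e; have [ltk yks] := yk_new kK Zk; have [ltl yls] := yk_new lK Zl.
have ykl : yk k = yk l.
  by move/setP/(_ (yk k)): e; rewrite !inE eqxx (negbTE yks) !orbF /= => /esym/eqP.
apply/eqP; apply: contraT => kl; have [yZl _] := ykP Zl.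
move/ZP: yZl => /(_ k kC kl); rewrite -ykl ltnNge => /negP; case.
exact: ltnW.
Qed.

Let incident_cell_of p : is_door (s, C) -> is_cell p -> incident (s, C) p ->
  exists2 k, k \in K & p = cell_of k.
Proof.
move=> door cell /(incident_card_eq1 door cell) /=.
move: cell => /andP[domp sp] [[y ys pE]|[k kC pE]]; rewrite {}pE /= in domp sp *.
  have [k kC km] : exists2 k, k \in C & rk k y < rk k (m k).
    have /dominantP/(_ y)[k kC kle] := domp; exists k => //.
    rewrite ltn_neqAle kle ?inE ?m_in ?orbT // andbT.
    by apply: contra ys => /eqP/rk_inj ->; exact: m_in.
  have others l : l \in C -> l != k -> rk l (m l) < rk l y.
    move=> lC lk; rewrite ltnNge; apply/negP => lle.
    have /subset_leq_card : s \subset m @: (C :\ k :\ l).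
      apply/fintype.subsetP => x xs; have /dominantP/(_ x)[i iC ile] := domp.
      apply/imsetP; exists i; last first.
        apply: (@rk_inj i); apply/eqP.
        by rewrite eqn_leq m_min // andbT ile // !inE m_in orbT.
      have yle : rk i x <= rk i y by rewrite ile // !inE eqxx.
      have key j : rk j y <= rk j (m j) -> i != j.
        move=> jle; apply/eqP => ij; subst j; case/negP: ys.
        suff -> : y = x by [].
        apply: (@rk_inj i); apply/eqP; rewrite eqn_leq yle andbT.
        exact: leq_trans jle (m_min _ xs).
      by rewrite !inE iC (key _ (ltnW km)) (key _ lle).
    move=> /leq_trans/(_ (leq_imset_card _ _)).
    by move: sC; rewrite (cardsD1 k) kC (cardsD1 l (C :\ k)) !inE lk lC => -[->]; rewrite ltnn.
  have yZ : y \in Z k by apply/ZP.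
  have kK : k \in K.
    rewrite -[_ \in K]negbK -ZmK //; apply/negP => mZ.
    have /dominantP/(_ (m k))[i iC ile] := domp.
    have [ik|ik] := eqVneq i k.
      by subst i; move: km; rewrite ltnNge ile // !inE eqxx.
    have /ZP/(_ i iC ik) := mZ; rewrite ltnNge ile // !inE m_in ?orbT //.
  exists k => //; have Z0 : Z k != finset.set0 by apply/set0Pn; exists y.
  rewrite /cell_of (negbTE Z0); suff -> : y = yk k by [].
  have [ykZ ykle] := ykP Z0; apply: (@rk_inj k); apply/eqP.
  rewrite eqn_leq ykle //=; have /dominantP/(_ (yk k))[i iC ile] := domp.
  have [ik|ik] := eqVneq i k.
    by subst i; apply: ile; rewrite !inE eqxx.
  have /ZP/(_ i iC ik) := ykZ; rewrite ltnNge ile // !inE m_in ?orbT //.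
have Z0 : Z k == finset.set0 by rewrite notdom.
exists k; last by rewrite /cell_of Z0.
by rewrite -[_ \in K]negbK -ZmK // (eqP Z0) inE.
Qed.

(** A door has one index too many: two indices have the same minimal vertex.  Each
    of the two can be freed in exactly one way, either by dropping it or by giving
    it a new vertex. *)
Lemma card_incident_cells : is_door (s, C) ->
  #|[set p | is_cell p && incident (s, C) p]| = 2.
Proof.
move=> door; rewrite -(@card_colliding _ _ m C) ?m_surj //.
rewrite -(card_in_imset cell_of_inj); apply: eq_card => p; rewrite !inE.
apply/andP/imsetP => [[cell inc]|[k kK ->]].
  by have [k kK ->] := incident_cell_of door cell inc; exists k.
by rewrite cell_ofP ?cell_of_incident.
Qed.

End DoorCells.

(** The empty door leads to a single cell, made of the highest point for [i0]. *)
Lemma card_incident_cells0 C : is_door (finset.set0, C) ->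
  #|[set p | is_cell p && incident (finset.set0, C) p]| = 1.
Proof.
move=> door; have CE : C = [set i0].
  move: door => /and4P[_ /= i0C /eqP]; rewrite cards0 => C1 _.
  by apply/eqP; rewrite eq_sym eqEcard finset.sub1set i0C cards1 C1 leqnn.
have [x1 _] := card_gt0P X_gt0.
pose y := [arg max_(y > x1) rk i0 y].
have ymax z : rk i0 z <= rk i0 y by rewrite /y; case: arg_maxnP => // w _; apply.
rewrite -(cards1 ([set y], [set i0])); apply: eq_card => p; rewrite !inE.
apply/andP/eqP => [[cell inc]|->].
  have [[z _ pE]|[k /= kC pE]] := incident_card_eq1 door cell inc.
    move: cell; rewrite pE /is_cell /= finset.setU0 CE => /andP[/dominantP/(_ y)[i]].
    rewrite inE => /eqP -> /(_ z); rewrite inE eqxx => /(_ isT) yz _.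
    suff -> : z = y by [].
    by apply: (@rk_inj i0); apply/eqP; rewrite eqn_leq ymax yz.
  move: cell; rewrite pE CE /is_cell /= => /andP[/dominantP/(_ x1)[i + _] _].
  by move: kC; rewrite CE !inE => /eqP ->; rewrite andNb.
split; last by rewrite /incident CE /= eqxx finset.sub0set.
rewrite /is_cell /= !cards1 eqxx andbT; apply/dominantP => z.
by exists i0; rewrite ?inE // => x; rewrite inE => /eqP ->.
Qed.

Lemma odd_incident_cells d : is_door d ->
  odd #|[set p | is_cell p && incident d p]| = (d == (finset.set0, [set i0])).
Proof.
case: d => s C door; have [s0|[x xs]] := set_0Vmem s.
  subst s; rewrite card_incident_cells0 //; apply/esym/eqP; congr (_, _).
  move: door => /and4P[_ /= i0C /eqP]; rewrite cards0 => C1 _.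
  by apply/eqP; rewrite eq_sym eqEcard finset.sub1set i0C cards1 C1 leqnn.
rewrite (card_incident_cells xs) //; last 2 first.
- by case/and4P: door.
- by case/and4P: door => _ _ /eqP.
by apply/esym/eqP => -[s0]; move: xs; rewrite s0 inE.
Qed.

Lemma incident_doorP t D d : is_cell (t, D) -> is_door d && incident d (t, D) =
  [&& i0 \in D, c @: d.1 == D :\ i0, d.2 == D & [exists x in t, d.1 == t :\ x]] ||
  [&& i0 \in d.2, c @: t == d.2 :\ i0, d.1 == t & [exists k in ~: D, d.2 == k |: D]].
Proof.
move=> cell; move: (cell) => /andP[/= dtD /eqP tD]; apply/andP/orP.
  case=> door inc; have [[y ys]|[k kC]] := incident_card_eq1 door cell inc.
    case: d door {inc} ys => s C /and4P[/= _ i0C _ cs] ys [-> ->].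
    left; rewrite i0C cs eqxx /=; apply/existsP; exists y; rewrite !inE eqxx /=.
    by rewrite setU1K.
  case: d door {inc} kC => s C /and4P[/= _ i0C _ cs] kC [-> ->].
  right; rewrite i0C cs eqxx /=; apply/existsP; exists k; rewrite !inE eqxx /=.
  by rewrite finset.setD1K.
case: d => s C /= [/and4P[i0D cs /eqP -> /existsP[x /andP[xt /eqP sE]]]|].
  rewrite /is_door /incident /= i0D cs eqxx !andbT; subst s.
  rewrite subD1set; split=> //; apply/andP; split.
    by apply: dominantS dtD; rewrite ?subD1set.
  by rewrite -tD (cardsD1 x t) xt add1n eqxx.
move=> /and4P[i0C ct /eqP -> /existsP[k /andP[kD /eqP CE]]].
rewrite inE in kD; rewrite /is_door /incident /= i0C ct eqxx !andbT; subst C.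
rewrite finset.subsetUr orbT; split=> //; apply/andP; split.
  by apply: dominantS dtD; rewrite ?finset.subsetUr.
by rewrite cardsU1 kD tD add1n eqxx.
Qed.

(** A cell whose colours are not exactly its indices has no door, or two: either
    one colour is repeated and one of its two vertices can be removed, or there is
    one foreign colour and one removes its vertex or adds it as an index. *)
Lemma odd_incident_doors p : is_cell p ->
  odd #|[set d | is_door d && incident d p]| = (c @: p.1 == p.2).
Proof.
case: p => t D cell; move: (cell) => /andP[/= dtD /eqP tD].
under eq_finset do rewrite incident_doorP //.
have [ct|ct] := eqVneq (c @: t) D.
  have cinj : {in t &, injective c} by apply/imset_injP; rewrite ct tD.
  have [i0D|i0D] := boolP (i0 \in D).
    have /imsetP[x xt cx] : i0 \in c @: t by rewrite ct.
    have cD y : y \in t -> (c @: (t :\ y) == D :\ i0) = (y == x).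
      move=> yt; have -> : c @: (t :\ y) = D :\ c y.
        apply/setP => i; rewrite !inE -ct; apply/imsetP/andP => [[z]|[iy /imsetP[z zt iE]]].
          rewrite !inE => /andP[zy zt] ->; split; last exact: imset_f.
          by apply: contra zy => /eqP/cinj ->.
        by exists z => //; rewrite !inE zt andbT; apply: contra iy => /eqP <-; rewrite iE.
      apply/eqP/eqP => [/setP/(_ i0)|->]; last by rewrite cx.
      rewrite !inE eqxx i0D !andbT /= => /negbFE; rewrite cx => /eqP/cinj.
      by move=> ->.
    rewrite -[RHS]/(odd 1) -(cards1 (t :\ x, D)); congr odd; apply: eq_card => -[s C].
    rewrite !inE ?i0D /= xpair_eqE; apply/orP/andP.
      case=> [/and3P[cs -> /existsP[y /andP[yt /eqP sE]]]|].
        by move: cs; rewrite sE cD // => /eqP ->.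
      move=> /and4P[_ /eqP ct' _ _]; move: i0D; rewrite -ct ct' !inE eqxx //.
    case=> /eqP -> /eqP ->; left; rewrite cD // !eqxx /=.
    by apply/existsP; exists x; rewrite xt eqxx.
  rewrite -[RHS]/(odd 1) -(cards1 (t, i0 |: D)); congr odd; apply: eq_card => -[s C].
  rewrite !inE ?(negbTE i0D) /= xpair_eqE; apply/and4P/andP.
    case=> i0C ct' -> /existsP[k /andP[kD /eqP CE]]; split=> //; subst C.
    by move: i0C; rewrite !inE (negbTE i0D) orbF => /eqP ->.
  case=> /eqP -> /eqP ->; rewrite !inE eqxx ct setU1K //; split=> //.
  by apply/existsP; exists i0; rewrite inE i0D eqxx.
have [i0D|i0D] := boolP (i0 \in D); last first.
  rewrite -[RHS]/(odd 0) -(cards0 ({set X} * {set I})%type); congr odd; apply: eq_card => -[s C].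
  rewrite !inE ?(negbTE i0D) /=; apply/negbTE/and4P => -[i0C ct' _ /existsP[k /andP[kD /eqP CE]]].
  subst C; move: i0C; rewrite !inE (negbTE i0D) orbF => /eqP i0k.
  by move: ct'; rewrite i0k setU1K ?(negbTE ct) // -i0k.
have [ct'|ct'] := eqVneq (c @: t) (D :\ i0).
  have cK : #|c @: t|.+1 = #|t| by rewrite ct' tD (cardsD1 i0 D) i0D.
  rewrite -[RHS]/(odd 2) -(card_colliding cK).
  have inj : {in colliding c t &, injective (fun x => (t :\ x, D))}.
    move=> x y; rewrite inE => /andP[xt _] _ [/setP/(_ x)].
    by rewrite !inE eqxx xt !andbT /= => /esym/negbFE/eqP.
  rewrite -(card_in_imset inj); congr odd; apply: eq_card => -[s C].
  rewrite !inE ?i0D /=; apply/orP/imsetP.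
    case=> [/and3P[cs /eqP -> /existsP[y /andP[yt /eqP sE]]]|].
      by exists y; rewrite ?sE // -imset_setD1_colliding // -sE (eqP cs) ct'.
    move=> /and4P[_ + _ /existsP[k /andP[+ /eqP CE]]]; subst C.
    rewrite ct' inE => /eqP/setP/(_ k) + kD; rewrite !inE eqxx (negbTE kD) andbF /= andbT.
    by move=> /esym/negbFE/eqP kE; rewrite kE i0D in kD.
  case=> x xK [-> ->]; left; have xt : x \in t by move: xK; rewrite inE => /andP[].
  rewrite eqxx /= -ct' imset_setD1_colliding // xK /=.
  by apply/existsP; exists x; rewrite xt eqxx.
have [/existsP[k /andP[kD /eqP ctk]]|/existsPn none] :=
    boolP [exists k in ~: D, c @: t == k |: (D :\ i0)]; last first.
  rewrite -[RHS]/(odd 0) -(cards0 ({set X} * {set I})%type); congr odd; apply: eq_card => -[s C].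
  rewrite !inE ?i0D /=; apply/negbTE/norP; split; apply/negP.
    move=> /and3P[/eqP cs _ /existsP[y /andP[yt /eqP sE]]].
    have tE : c @: t = c y |: (D :\ i0).
      by rewrite -(finset.setD1K yt) imsetU1 -sE cs.
    have [cyD|cyD] := boolP (c y \in D); last first.
      by have := none (c y); rewrite inE cyD tE eqxx.
    have [ci|ci] := eqVneq (c y) i0.
      by case/eqP: ct; rewrite tE ci finset.setD1K.
    case/eqP: ct'; rewrite tE; apply/setP => i; rewrite !inE.
    by have [->|] := eqVneq i (c y); rewrite ?ci ?cyD.
  move=> /and4P[_ /eqP tE _ /existsP[k /andP[+ /eqP CE]]]; rewrite inE => kD; subst C.
  have := none k; rewrite inE kD tE /= => /eqP; case; apply/setP => i; rewrite !inE.
  by have [->|] := eqVneq i k; rewrite ?andbT //= ; apply/eqP => ki; rewrite ki i0D in kD.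
rewrite inE in kD.
have ki0 : k != i0 by apply: contra kD => /eqP ->.
have cinj : {in t &, injective c}.
  apply/imset_injP; rewrite ctk cardsU1 !inE (negbTE kD) andbF tD.
  by rewrite (cardsD1 i0 D) i0D eqxx.
have /imsetP[x xt cx] : k \in c @: t by rewrite ctk !inE eqxx.
have pair_neq : (t :\ x, D) != (t, k |: D).
  by apply/eqP => -[/setP/(_ x)]; rewrite !inE eqxx xt.
rewrite -[RHS]/(odd 2); have <- : #|[set (t :\ x, D); (t, k |: D)]| = 2 by rewrite cards2 pair_neq.
congr odd; apply: eq_card => -[s C].
rewrite !inE ?i0D /= !xpair_eqE; apply/orP/orP.
  case=> [/and3P[/eqP cs /eqP -> /existsP[y /andP[yt /eqP sE]]]|].
    left; rewrite sE eqxx andbT; suff -> : y = x by [].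
    apply: cinj => //; rewrite -cx; apply/eqP; apply: contraT => cy.
    have : k \in c @: (t :\ y).
      by rewrite cx imset_f // !inE xt andbT; apply: contra cy => /eqP xy; rewrite cx xy.
    by rewrite -sE cs !inE (negbTE kD) andbF.
  move=> /and4P[_ /eqP tE /eqP -> /existsP[l /andP[+ /eqP CE]]]; rewrite inE => lD; subst C.
  right; rewrite eqxx /=; suff -> : l = k by [].
  move/setP/(_ k): tE; rewrite ctk !inE eqxx ki0 (negbTE kD) !orbF /= => /esym/eqP; exact.
case=> /andP[/eqP -> /eqP ->]; [left|right].
  rewrite eqxx /=; apply/andP; split; last by apply/existsP; exists x; rewrite xt eqxx.
  apply/eqP/setP => i; rewrite inE finset.in_set1; apply/imsetP/andP => [[z]|[ii iD]].
    rewrite !inE => /andP[zx zt] ->; have : c z \in c @: t by rewrite imset_f.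
    rewrite ctk !inE => /orP[/eqP cz|/andP[//]].
    by case/eqP: zx; apply: cinj => //; rewrite -cx.
  have /imsetP[z zt iE] : i \in c @: t by rewrite ctk !inE ii iD orbT.
  exists z => //; rewrite !inE zt andbT; apply/eqP => zx.
  by rewrite iE zx -cx (negbTE kD) in iD.
rewrite !inE i0D orbT eqxx /=; apply/andP; split; last first.
  by apply/existsP; exists k; rewrite inE kD eqxx.
rewrite ctk; apply/eqP/setP => i; rewrite !inE.
by have [->|] := eqVneq i k; rewrite ?ki0.
Qed.

(** Counting incidences modulo 2: on the side of the doors only the empty door
    contributes, so the number of cells with [c @: s = C] is odd. *)
Theorem scarf : exists s C, [/\ s != finset.set0, dominant s C & c @: s = C].
Proof.
pose n := \sum_(d | is_door d) \sum_(p | is_cell p && incident d p) 1.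
have odd_sum (T : finType) (P : pred T) (F : T -> nat) :
    odd (\sum_(i | P i) F i) = odd #|[set i | P i && odd (F i)]|.
  rewrite -sum1dep_card big_mkcondr /=.
  elim/big_rec2: _ => // i a b _ e; rewrite !oddD e; case: (odd (F i)) => //.
have : odd n.
  rewrite odd_sum (_ : [set _ | _] = [set (finset.set0, [set i0])]) ?cards1 //.
  apply/setP => d; rewrite !inE sum1dep_card; apply/andP/eqP.
    by case=> door; rewrite odd_incident_cells // => /eqP.
  move=> ->; suff door : is_door (finset.set0, [set i0]) by rewrite odd_incident_cells ?eqxx.
  rewrite /is_door /= set11 cards0 cards1 imset0 finset.setDv !eqxx !andbT.
  by apply/dominantP => y; exists i0; rewrite ?inE // => x; rewrite inE.
rewrite /n (exchange_big_dep is_cell) /=; last by move=> d p _ /andP[].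
rewrite odd_sum.
have [->|[[s C]]] := set_0Vmem [set p | is_cell p &&
    odd (\sum_(d | is_door d && (is_cell p && incident d p)) 1)].
  by rewrite cards0.
rewrite !inE => /andP[cell].
under eq_bigl do rewrite cell /=.
rewrite sum1dep_card odd_incident_doors //= => /eqP cs _.
move: cell => /andP[/= dsC /eqP sC]; exists s, C; split=> //.
apply/eqP => s0; have [x _] := card_gt0P X_gt0.
have /dominantP/(_ x)[i] := dsC.
by rewrite -cs s0 imset0 inE.
Qed.

End Scarf.

(** * Brouwer's fixed point theorem on a simplex *)

Section Grid.
Variables (n' m : nat).
Let n := n'.+1.

Definition grid := {x : {ffun 'I_n -> 'I_m.+1} | (\sum_i (x i : nat) == m)%N}.

Definition gcoord (x : grid) (i : 'I_n) : nat := val x i.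

Lemma sum_gcoord (x : grid) : (\sum_i gcoord x i = m)%N.
Proof. exact/eqP/(valP x). Qed.

Lemma exists_grid (h : 'I_n -> nat) : (\sum_i h i = m)%N -> exists x : grid, gcoord x =1 h.
Proof.
move=> hm.
have hle i : (h i < m.+1)%N by rewrite ltnS -hm (bigD1 i) //= leq_addr.
have xP : (\sum_i [ffun i => Ordinal (hle i)] i == m)%N.
  by apply/eqP; apply: etrans hm; apply: eq_bigr => i _; rewrite ffunE.
by exists (Sub [ffun i => Ordinal (hle i)] xP) => i; rewrite /gcoord /= ffunE.
Qed.

(** The coordinate [i], with ties broken by an enumeration of the grid. *)
Let rk (i : 'I_n) (x : grid) : nat := (gcoord x i * #|{: grid}| + enum_rank x)%N.

Let rk_inj i : injective (rk i).
Proof.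
move=> x y /(congr1 (modn^~ #|{: grid}|)).
by rewrite !modnMDl !modn_small // => /ord_inj/enum_rank_inj.
Qed.

Let rk_le i x y : (rk i x <= rk i y -> gcoord x i <= gcoord y i)%N.
Proof.
rewrite leqNgt => xy; rewrite leqNgt; apply: contra xy => lt.
rewrite /rk; apply: (@leq_trans ((gcoord y i).+1 * #|{: grid}|)).
  by rewrite mulSn addnC ltn_add2r.
by apply: leq_trans (leq_addr _ _); rewrite leq_mul2r lt orbT.
Qed.

(** Dominant families of grid points are small.  If [mu i] is the least coordinate
    [i] on [s], no grid point has all its coordinates in [C] at least [mu i + 1],
    so the numbers [mu i + 1], for [i] in [C], add up to more than [m]; this leaves
    room for at most [n] above [mu]. *)
Lemma scarf_grid (c : grid -> 'I_n) : exists (s : {set grid}) (C : {set 'I_n}),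
  [/\ s != finset.set0, c @: s = C,
      forall x y i, x \in s -> y \in s -> (gcoord x i <= gcoord y i + n)%N
    & forall x i, x \in s -> i \notin C -> (gcoord x i <= n)%N].
Proof.
have grid_gt0 : (0 < #|{: grid}|)%N.
  have [x _] : exists x : grid, gcoord x =1 (fun i => if i == ord0 then m else 0%N).
    by apply: exists_grid; rewrite -big_mkcond big_pred1_eq.
  by apply/card_gt0P; exists x.
have [s [C [s0 /dominantP dsC cs]]] := scarf c ord0 rk_inj grid_gt0.
have [x0 x0s] := set0Pn _ s0.
pose mu i := if i \in C then gcoord [arg min_(x < x0 in s) gcoord x i]%N i else 0%N.
have mu_le x i : x \in s -> (mu i <= gcoord x i)%N.
  by rewrite /mu; case: ifP => // _ xs; case: arg_minnP => // y ys; apply.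
have bound : (m < \sum_i (mu i + (i \in C)))%N.
  rewrite ltnNge; apply/negP => le; have jC : c x0 \in C by rewrite -cs imset_f.
  pose nu i := (mu i + (i \in C))%N.
  pose h i := (nu i + (if i == c x0 then m - \sum_i nu i else 0))%N.
  have [y yE] : exists y : grid, gcoord y =1 h.
    by apply: exists_grid; rewrite big_split /= -big_mkcond big_pred1_eq subnKC.
  have [i iC ile] := dsC y; have : (h i <= mu i)%N.
    by rewrite -yE /mu iC; apply: rk_le; apply: ile; case: arg_minnP.
  by rewrite /h /nu iC addn1 addSn ltnNge leq_addr.
have dif x i : x \in s -> (gcoord x i <= mu i + n)%N.
  move=> xs; have : (\sum_i (mu i + (i \in C)) <= \sum_i mu i + n)%N.
    rewrite big_split leq_add2l /= -[X in (_ <= X)%N]card_ord -sum1_card.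
    by apply: leq_sum => j _; exact: leq_b1.
  move/(leq_trans bound); rewrite -{1}(sum_gcoord x) (bigD1 i) //=.
  rewrite [in X in (_ < X)%N](bigD1 i) //=.
  have : (\sum_(j < n | j != i) mu j <= \sum_(j < n | j != i) gcoord x j)%N.
    by apply: leq_sum => j _; exact: mu_le.
  by move: (bigop.body _ _ _) (bigop.body _ _ _) => a b; lia.
exists s, C; split=> // [x y i xs ys|x i xs iC].
  by apply: leq_trans (dif x i xs) _; rewrite leq_add2r mu_le.
by have := dif x i xs; rewrite /mu (negbTE iC).
Qed.

End Grid.

Lemma continuous_sum (R : realType) (V : normedModType R) (T : topologicalType)
    (I : finType) (F : I -> T -> V) :
  (forall i, continuous (F i)) -> continuous (fun x => \sum_i F i x)%R.
Proof.
move=> cF; apply: (@continuous_big V I _ _ xpredT); first exact: add_continuous.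
by move=> i _; exact: cF.
Qed.

Section Simplex.
Local Open Scope ring_scope.
Local Open Scope classical_set_scope.
Variables (R : realType) (n : nat).

Definition simplex : set 'rV[R]_n :=
  [set v | (forall i, 0 <= v ord0 i) /\ \sum_i v ord0 i = 1].

Lemma simplex_le1 v i : simplex v -> v ord0 i <= 1.
Proof.
by case=> v0 <-; rewrite (bigD1 i) //= lerDl sumr_ge0.
Qed.

Lemma compact_simplex : compact simplex.
Proof.
apply: (@subclosed_compact _ _ [set v : 'rV[R]_n | forall i, `[0, 1]%classic (v ord0 i)]).
- have -> : simplex = (\bigcap_(i in [set: 'I_n]) ((fun v => v ord0 i) @^-1` [set x | 0 <= x]))
      `&` ((fun v => \sum_i v ord0 i) @^-1` [set x | x = 1]).
    by apply/seteqP; split=> v [v0 v1]; split=> // i; [move=> _|]; exact: (v0 i).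
  apply: closedI.
    apply: closed_bigI => i _; apply: preimage_closed; last exact: closed_ge.
    by move=> v _; exact: coord_continuous.
  apply: preimage_closed; last exact: closed_eq.
  move=> v _; apply: (@continuous_sum _ R^o) => i.
  exact: coord_continuous.
- by apply: (@rV_compact R n (fun=> `[0, 1]%classic)) => _; exact: segment_compact.
- by move=> v sv i /=; rewrite in_itv /= simplex_le1 // andbT; case: sv.
Qed.

End Simplex.
Arguments simplex {R n}.

Section Brouwer.
Local Open Scope ring_scope.
Local Open Scope classical_set_scope.

(** For [F] with a positive sum this says that the normalized map [F / \sum F] has
    a fixed point; the form below spares the division.  Without such a point, a
    compactness argument gives [e > 0] such that near every [v] some index [i]
    satisfies [F i u < u_i * S u] and [u_i > e] uniformly.  On a grid finer than
    [e], colour each vertex with an index for which the opposite inequality holds;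
    a small rainbow family is then contradictory: an index of [C] is the colour of
    one of its vertices, and the other coordinates are below [e]. *)
Theorem simplex_fixpoint (R : realType) (n : nat) (F : 'I_n -> 'rV[R]_n -> R) :
  (0 < n)%N -> (forall i, continuous (F i)) ->
  (forall i v, simplex v -> 0 <= F i v) ->
  exists2 v, simplex v & forall i, F i v = v ord0 i * \sum_j F j v.
Proof.
case: n F => // n' F _ cF F0; apply: contrapT => nofix.
pose S v := \sum_j F j v.
have cS : continuous S by exact: (@continuous_sum _ R^o).
have sum_zero v : simplex v -> \sum_i (F i v - v ord0 i * S v) = 0.
  by case=> _ v1; rewrite sumrB -mulr_suml v1 mul1r subrr.
have exlt v : simplex v -> exists i, F i v < v ord0 i * S v.
  move=> sv; apply: contrapT => ge; apply: nofix; exists v => // i.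
  apply/eqP; rewrite -subr_eq0; apply/eqP; apply: (psumr_eq0P _ (sum_zero v sv)) => // j _.
  by rewrite subr_ge0 leNgt; apply/negP => lt; apply: ge; exists j.
pose P e (v : 'rV[R]_n'.+1) := exists i, forall u : 'rV[R]_n'.+1,
  ball v e u -> F i u < u ord0 i * S u /\ e < u ord0 i.
have nearP : \forall e \near 0^'+, simplex `<=` P e.
  have /compact_near_coveringP := @compact_simplex R n'.+1; apply => v sv.
  have [i lt] := exlt v sv.
  have vi : 0 < v ord0 i.
    have [v0 _] := sv; rewrite lt0r v0 andbT; apply: contraTneq lt => ->.
    by rewrite mul0r -leNgt F0.
  have c1 : continuous (fun u : 'rV[R]_n'.+1 => u ord0 i) by exact: coord_continuous.
  have cG : continuous (fun u : 'rV[R]_n'.+1 => u ord0 i * S u - F i u).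
    by move=> u; exact: (cvgB (cvgM (c1 u) (cS u)) (cF i u)).
  rewrite -subr_gt0 in lt; have half : v ord0 i / 2 < v ord0 i.
    by rewrite ltr_pdivrMr // ltr_pMr // ltr1n.
  have : \forall u \near v, F i u < u ord0 i * S u /\ v ord0 i / 2 < u ord0 i.
    near=> u; split; last by near: u; exact: (cvgr_gt _ (c1 v)).
    by rewrite -subr_gt0; near: u; exact: (cvgr_gt _ (cG v)).
  move=> /nbhs_ballP[r /= r0 rP].
  exists (ball v (r / 2), [set e | e < Num.min (r / 2) (v ord0 i / 2)]).
    split=> /=; first by apply: nbhsx_ballx; rewrite divr_gt0.
    by apply: nbhs_right_lt; rewrite lt_min !divr_gt0.
  move=> [u e] [/= uv]; rewrite lt_min => /andP[er ev]; exists i => w uw.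
  have [] := rP w; last by move=> ? ?; split=> //; exact: lt_trans ev _.
  rewrite [r]splitr; apply: ball_triangle uv _; apply: le_ball uw; exact: ltW.
have [e [e0 eP]] : exists e, 0 < e /\ simplex `<=` P e.
  have [e] := @filter_ex _ (0^'+ : set_system R) _ _ (filterI (nbhs_right_gt 0) nearP).
  by case; exists e.
have [m me] : exists m, (0 < m)%N /\ n'.+1%:R / m%:R < e.
  exists (Num.bound (n'.+1%:R / e)).+1; split=> //.
  rewrite ltr_pdivrMr ?ltr0n // mulrC -ltr_pdivrMr //.
  apply: lt_trans (archi_boundP _) _; first by rewrite divr_ge0 // ltW.
  by rewrite ltr_nat.
case: me => m_gt0 me; have m0 : 0 < m%:R :> R by rewrite ltr0n.
pose vtx (x : grid n' m) : 'rV[R]_n'.+1 := \row_i ((gcoord x i)%:R / m%:R).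
have svtx x : simplex (vtx x).
  split=> [i|]; first by rewrite mxE divr_ge0.
  under eq_bigr do rewrite mxE.
  by rewrite -mulr_suml -natr_sum sum_gcoord divff // gt_eqF.
have /choice[c cP] : forall x, exists i, vtx x ord0 i * S (vtx x) <= F i (vtx x).
  move=> x; apply: contrapT => lt.
  have lt' i : 0 <= vtx x ord0 i * S (vtx x) - F i (vtx x).
    by rewrite subr_ge0 leNgt; apply/negP => /ltW le; apply: lt; exists i.
  have zero : \sum_i (vtx x ord0 i * S (vtx x) - F i (vtx x)) = 0.
    apply: (etrans _ (etrans (congr1 -%R (sum_zero _ (svtx x))) (oppr0 _))).
    by rewrite -sumrN; apply: eq_bigr => i _; rewrite opprB.
  apply: lt; exists ord0; rewrite -subr_le0.
  by rewrite (psumr_eq0P (fun i _ => lt' i) zero).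
have [s [C [/set0Pn[x xs] cs near_s far_s]]] := scarf_grid c.
have [i iP] := eP _ (svtx x).
have [iC|iC] := boolP (i \in C); last first.
  have [_] := iP _ (ballxx _ e0); rewrite mxE ltNge => /negP; apply.
  apply: le_trans (ltW me); rewrite ler_pM2r ?invr_gt0 // ler_nat.
  exact: far_s iC.
move: iC; rewrite -cs => /imsetP[y ys iE].
have [] := iP (vtx y); last by rewrite iE ltNge cP.
split=> // j k; rewrite /ball /= !mxE -mulrBl normrM [`|_^-1|]gtr0_norm ?invr_gt0 //.
apply: le_lt_trans me; rewrite ler_pM2r ?invr_gt0 // ler_norml.
have := near_s _ _ k xs ys; have := near_s _ _ k ys xs.
by rewrite -!(ler_nat R) !natrD; lra.
Unshelve. all: by end_near. Qed.

End Brouwer.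

Local Open Scope classical_set_scope.
Local Open Scope ring_scope.


(** * The Hahn-Banach theorem *)

Section HahnBanach.
Variables (R : realType) (V : lmodType R).
Implicit Types (p q : V -> R) (u v : V).

Definition sublinear p :=
  (forall u v, p (u + v) <= p u + p v) /\ (forall a v, 0 <= a -> p (a *: v) = a * p v).

Lemma sublinear0 p : sublinear p -> p 0 = 0.
Proof. by case=> _ pZ; rewrite -(scale0r 0) pZ // mul0r. Qed.

Lemma sublinear_ge p v : sublinear p -> - p (- v) <= p v.
Proof.
move=> sp; have [pD _] := sp; have := pD (- v) v.
by rewrite addNr sublinear0 //; lra.
Qed.

Lemma sublinear_inf (A : set (V -> R)) :
  A !=set0 -> (forall v, has_lbound [set q v | q in A]) -> (forall q, A q -> q 0 = 0) ->
  (forall q1 q2 u v, A q1 -> A q2 -> exists2 q, A q & q (u + v) <= q1 u + q2 v) ->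
  (forall q a v, A q -> 0 < a -> exists2 q', A q' & q' (a *: v) <= a * q v) ->
  sublinear (fun v => inf [set q v | q in A]).
Proof.
move=> [q0 Aq0] lbA A0 AD AZ.
pose h v := inf [set q v | q in A]; rewrite -/h.
have ne v : [set q v | q in A] !=set0 by exists (q0 v), q0.
have h_le q v : A q -> h v <= q v by move=> Aq; apply: ge_inf => //; exists q.
have le_h x v : (forall q, A q -> x <= q v) -> x <= h v.
  by move=> xle; apply: lb_le_inf => // _ [q Aq <-]; exact: xle.
have hZ_le a v : 0 < a -> h (a *: v) <= a * h v.
  move=> a0; rewrite mulrC -ler_pdivrMr //; apply: (le_h) => q Aq.
  rewrite ler_pdivrMr // mulrC; have [q' Aq' le] := AZ q a v Aq a0.
  exact: le_trans (h_le _ _ Aq') le.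
split=> [u v|a v].
  rewrite -lerBlDr; apply: (le_h) => q1 Aq1; rewrite lerBlDl -lerBlDr.
  apply: (le_h) => q2 Aq2; rewrite lerBlDl.
  have [q Aq le] := AD q1 q2 u v Aq1 Aq2.
  exact: le_trans (h_le _ _ Aq) le.
rewrite le_eqVlt => /predU1P[<-|a0].
  rewrite scale0r mul0r; apply/eqP; rewrite eq_le; apply/andP; split.
    by have := h_le _ 0 Aq0; rewrite (A0 q0).
  by apply: (le_h) => q Aq; rewrite (A0 q).
apply/eqP; rewrite eq_le hZ_le //= mulrC -ler_pdivlMr // mulrC.
have : h (a^-1 *: (a *: v)) <= a^-1 * h (a *: v) by rewrite hZ_le ?invr_gt0.
by rewrite scalerA mulVf ?gt_eqF // scale1r.
Qed.

(** The infimum of [q (v + t *: a) - t * q a] over [t >= 0] is the largest sublinear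
    functional below [q] with value at most [- q a] at [- a]. *)
Lemma sublinear_lower q a : sublinear q ->
  exists q', [/\ sublinear q', forall v, q' v <= q v & q' (- a) <= - q a].
Proof.
move=> sq; have [qD qZ] := sq.
pose A := [set (fun v => q (v + t *: a) - t * q a) | t in [set t : R | 0 <= t]].
have lbA v : has_lbound [set q' v | q' in A].
  exists (- q (- v)) => _ [_ [t /= t0 <-] <-].
  rewrite -(qZ _ _ t0); have := qD (v + t *: a) (- v); rewrite addrAC subrr add0r; lra.
have q'_le t v : 0 <= t -> inf [set q' v | q' in A] <= q (v + t *: a) - t * q a.
  move=> t0; apply: ge_inf => //; exists (fun v => q (v + t *: a) - t * q a) => //.
  by exists t.
exists (fun v => inf [set q' v | q' in A]); split.
- apply: sublinear_inf => //.
  + by exists (fun v => q (v + 0 *: a) - 0 * q a), 0 => //=.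
  + by move=> _ [t t0 <-]; rewrite add0r qZ // subrr.
  + move=> _ _ u v [t1 /= t10 <-] [t2 /= t20 <-].
    exists (fun v => q (v + (t1 + t2) *: a) - (t1 + t2) * q a).
      by exists (t1 + t2) => //=; rewrite addr_ge0.
    have := qD (u + t1 *: a) (v + t2 *: a); rewrite addrACA -scalerDl; lra.
  + move=> _ c v [t /= t0 <-] c0; exists (fun v => q (v + (c * t) *: a) - (c * t) * q a).
      by exists (c * t) => //=; rewrite mulr_ge0 // ltW.
    by rewrite -scalerA -scalerDr (qZ _ _ (ltW c0)) mulrBr mulrA lexx.
- by move=> v; have := q'_le 0 v (lexx _); rewrite scale0r addr0 mul0r subr0.
- have := q'_le 1 (- a) ler01; rewrite scale1r addNr sublinear0 // mul1r; lra.
Qed.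

Lemma sublinear_minimal p : sublinear p ->
  exists q, [/\ sublinear q, forall v, q v <= p v &
    forall q', sublinear q' -> (forall v, q' v <= q v) -> q' = q].
Proof.
move=> sp; pose below q := sublinear q /\ forall v, q v <= p v.
pose T := {q : V -> R | below q}.
pose r (x y : T) : bool := `[< forall v, sval y v <= sval x v >].
have [||||x xmin] := @Zorn T r.
- by move=> x; apply/asboolP => v.
- move=> x y z /asboolP xy /asboolP yz; apply/asboolP => v.
  exact: le_trans (yz v) (xy v).
- move=> [x Px] [y Py] /asboolP /= xy /asboolP /= yx; apply: eq_exist; apply/funext => v.
  by apply/eqP; rewrite eq_le xy yx.
- move=> A Atot; have [A0|/nonemptyPn Ane] := pselect (A !=set0); last first.
    by exists (exist below p (conj sp (fun v => lexx _))) => x; rewrite Ane.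
  have [x0 Ax0] := A0; pose B := [set sval x | x in A].
  have lbB v : has_lbound [set q v | q in B].
    exists (- p (- v)) => _ [_ [x Ax <-] <-]; have [sx xp] := svalP x.
    by have := sublinear_ge v sx; have := xp (- v); lra.
  have q_le x v : A x -> inf [set q v | q in B] <= sval x v.
    by move=> Ax; apply: ge_inf => //; exists (sval x) => //; exists x.
  have sq : sublinear (fun v => inf [set q v | q in B]).
    apply: sublinear_inf => //.
    + by exists (sval x0), x0.
    + by move=> _ [x Ax <-]; have [sx _] := svalP x; exact: sublinear0.
    + move=> _ _ u v [x Ax <-] [y Ay <-]; have [[xD _] _] := svalP x.
      have [[yD _] _] := svalP y.
      have [/asboolP xy|/asboolP yx] := Atot _ _ Ax Ay.
        by exists (sval y); [exists y|rewrite (le_trans (yD _ _)) // lerD2r].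
      by exists (sval x); [exists x|rewrite (le_trans (xD _ _)) // lerD2l].
    + move=> _ a v [x Ax <-] a0; exists (sval x); first by exists x.
      by have [[_ xZ] _] := svalP x; rewrite xZ // ltW.
  have qp v : inf [set q v | q in B] <= p v.
    by have [_ x0p] := svalP x0; exact: le_trans (q_le _ v Ax0) (x0p v).
  by exists (exist below _ (conj sq qp)) => x Ax; apply/asboolP => v; exact: q_le.
case: x xmin => q [sq qp] qmin; exists q; split=> // q' sq' q'q.
have q'p v : q' v <= p v by exact: le_trans (q'q v) (qp v).
suff /(congr1 sval) : exist below q' (conj sq' q'p) = exist below q (conj sq qp) by [].
by apply: qmin; apply/asboolP.
Qed.

(** Linear functionals are the minimal sublinear ones: minimality makes [q] equal to
    each of its lowerings, hence odd, and an odd sublinear functional is linear. *)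
Theorem hahn_banach p : sublinear p ->
  exists phi : V -> R, scalar phi /\ forall v, phi v <= p v.
Proof.
move=> /sublinear_minimal[q [sq qp qmin]]; exists q; split=> //.
have qN v : q (- v) = - q v.
  have [q' [sq' q'q q'N]] := sublinear_lower v sq.
  by rewrite -(qmin _ sq' q'q) in sq q'N *; have := sublinear_ge (- v) sq; rewrite opprK; lra.
have [qD qZ] := sq.
have qDE u v : q (u + v) = q u + q v.
  by have := qD (- u) (- v); have := qD u v; rewrite -opprD !qN; lra.
move=> a u v; rewrite qDE; congr (_ + _).
have [a0|a0] := leP 0 a; first exact: qZ.
by rewrite -[a]opprK scaleNr qN qZ ?mulNr // oppr_ge0 ltW.
Qed.

Lemma norming_functional p v0 : sublinear p ->
  exists phi : V -> R, [/\ scalar phi, forall v, phi v <= p v & phi v0 = p v0].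
Proof.
move=> sp; have [q [sq qp qN]] := sublinear_lower v0 sp.
have [phi [sphi phiq]] := hahn_banach sq; exists phi.
have phip v : phi v <= p v by exact: le_trans (phiq v) (qp v).
split=> //; have := phip v0; have := phiq (- v0).
have -> : phi (- v0) = - phi v0.
  have := sphi (- 1) v0 0; rewrite addr0 scaleN1r => ->.
  by have := sphi (- 1) 0 0; rewrite addr0 scaler0; lra.
by lra.
Qed.

End HahnBanach.

(** * Dual norms *)

Section Scalar.
Variables (R : realType) (V : lmodType R).
Implicit Types (phi psi : V -> R) (u v : V).

Lemma scalar_add phi u v : scalar phi -> phi (u + v) = phi u + phi v.
Proof. by move=> /(_ 1 u v); rewrite scale1r mul1r. Qed.

Lemma scalar_0 phi : scalar phi -> phi 0 = 0.
Proof. by move=> sp; have := scalar_add 0 0 sp; rewrite addr0; lra. Qed.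

Lemma scalar_scale phi a v : scalar phi -> phi (a *: v) = a * phi v.
Proof. by move=> sp; have := sp a v 0; rewrite (scalar_0 sp) !addr0. Qed.

Lemma scalar_opp phi v : scalar phi -> phi (- v) = - phi v.
Proof. by move=> sp; rewrite -scaleN1r scalar_scale // mulN1r. Qed.

Lemma scalar_sub phi u v : scalar phi -> phi (u - v) = phi u - phi v.
Proof. by move=> sp; rewrite scalar_add // scalar_opp. Qed.

Lemma scalar_sum phi (I : Type) (r : seq I) (F : I -> V) :
  scalar phi -> phi (\sum_(i <- r) F i) = \sum_(i <- r) phi (F i).
Proof.
move=> sp; elim: r => [|i r IH]; first by rewrite !big_nil scalar_0.
by rewrite !big_cons scalar_add // IH.
Qed.

Lemma scalar_comb phi psi a b :
  scalar phi -> scalar psi -> scalar (fun v => a * phi v + b * psi v).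
Proof. by move=> sp sq c u v; rewrite sp sq /=; ring. Qed.

End Scalar.

Section Norm.
Variables (R : realType) (V : lmodType R) (N : V -> R).
Hypothesis hN : is_norm N.
Implicit Types (phi psi : V -> R) (u v : V).

Lemma is_norm_sublinear : sublinear N.
Proof. by case: hN => _ ND NZ; split=> // a v a0; rewrite NZ ger0_norm. Qed.

Lemma is_norm0 : N 0 = 0.
Proof. exact: sublinear0 is_norm_sublinear. Qed.

Lemma is_normN v : N (- v) = N v.
Proof. by case: hN => _ _ NZ; rewrite -scaleN1r NZ normrN1 mul1r. Qed.

Lemma is_norm_ge0 v : 0 <= N v.
Proof. by have := sublinear_ge v is_norm_sublinear; rewrite is_normN; lra. Qed.

Lemma is_norm_gt0 v : v != 0 -> 0 < N v.
Proof.
by case: hN => N0 _ _ v0; rewrite lt0r is_norm_ge0 andbT; apply: contra v0 => /eqP/N0 ->.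
Qed.

Lemma exists_norming v0 :
  exists phi, [/\ scalar phi, forall v, `|phi v| <= N v & phi v0 = N v0].
Proof.
have [phi [sp phiN phi0]] := norming_functional v0 is_norm_sublinear.
exists phi; split=> // v; rewrite ler_norml phiN andbT lerNl.
by rewrite -scalar_opp // -is_normN; exact: phiN.
Qed.

Definition opnorm phi : R := fine (dual_norm N phi).

Lemma dual_norm_le phi (c : R) :
  (forall v, `|phi v| <= c * N v) -> 0 <= c -> (dual_norm N phi <= c%:E)%E.
Proof.
move=> phic c0; apply: ge_ereal_sup => _ [v /= v1 <-]; rewrite lee_fin.
by apply: le_trans (phic v) _; rewrite ler_piMr.
Qed.

Lemma dual_norm_ge phi v : N v <= 1 -> (`|phi v|%:E <= dual_norm N phi)%E.
Proof. by move=> v1; apply: ereal_sup_ubound; exists v. Qed.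

Lemma dual_normE phi : dual N phi -> dual_norm N phi = (opnorm phi)%:E.
Proof.
move=> [sp [k phik]]; rewrite /opnorm fineK //.
have ge : (0%:E <= dual_norm N phi)%E.
  by have := @dual_norm_ge phi 0; rewrite is_norm0 scalar_0 // normr0; apply; exact: ler01.
have le : (dual_norm N phi <= (Num.max k 0)%:E)%E.
  apply: dual_norm_le; last by rewrite le_max lexx orbT.
  by move=> v; apply: le_trans (phik v) _; rewrite ler_wpM2r ?is_norm_ge0 // le_max lexx.
by rewrite fin_real // (lt_le_trans _ ge) ?ltNyr //= (le_lt_trans le) ?ltry.
Qed.

Lemma opnorm_ge0 phi : dual N phi -> 0 <= opnorm phi.
Proof.
move=> dp; rewrite -lee_fin -dual_normE //; have [sp _] := dp.
by have := @dual_norm_ge phi 0; rewrite is_norm0 scalar_0 // normr0; apply; exact: ler01.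
Qed.

Lemma opnorm_bound phi v : dual N phi -> `|phi v| <= opnorm phi * N v.
Proof.
move=> dp; have [sp _] := dp; have [->|v0] := eqVneq v 0.
  by rewrite scalar_0 // is_norm0 mulr0 normr0.
have Nv := is_norm_gt0 v0; have [_ _ NZ] := hN.
have : (`|phi ((N v)^-1 *: v)|%:E <= dual_norm N phi)%E.
  apply: dual_norm_ge; rewrite NZ gtr0_norm ?invr_gt0 //.
  by rewrite mulVf // gt_eqF.
rewrite dual_normE // lee_fin scalar_scale // normrM gtr0_norm ?invr_gt0 //.
by rewrite mulrC ler_pdivrMr.
Qed.

Lemma opnorm_le phi c :
  dual N phi -> (forall v, `|phi v| <= c * N v) -> 0 <= c -> opnorm phi <= c.
Proof. by move=> dp le c0; rewrite -lee_fin -dual_normE // dual_norm_le. Qed.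

Lemma dual_comb phi psi a b :
  dual N phi -> dual N psi -> dual N (fun v => a * phi v + b * psi v).
Proof.
move=> dp dq; split; first by apply: scalar_comb; [case: dp|case: dq].
exists (`|a| * opnorm phi + `|b| * opnorm psi) => v.
rewrite (le_trans (ler_normD _ _)) // !normrM mulrDl -!mulrA.
by apply: lerD; apply: ler_wpM2l => //; exact: opnorm_bound.
Qed.

Lemma dualD phi psi a : dual N phi -> dual N psi -> dual N (fun v => phi v + a * psi v).
Proof.
move=> dp dq; suff -> : (fun v => phi v + a * psi v) = (fun v => 1 * phi v + a * psi v).
  exact: dual_comb.
by apply/funext => v; rewrite mul1r.
Qed.

Lemma dualB phi psi : dual N phi -> dual N psi -> dual N (fun v => phi v - psi v).
Proof.
move=> dp dq; suff -> : (fun v => phi v - psi v) = (fun v => phi v + (-1) * psi v).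
  exact: dualD.
by apply/funext => v; rewrite mulN1r.
Qed.

Lemma dualZ phi a : dual N phi -> dual N (fun v => a * phi v).
Proof.
move=> dp; suff -> : (fun v => a * phi v) = (fun v => 0 * phi v + a * phi v).
  exact: dual_comb.
by apply/funext => v; rewrite mul0r add0r.
Qed.

Lemma opnormD phi psi a : dual N phi -> dual N psi ->
  opnorm (fun v => phi v + a * psi v) <= opnorm phi + `|a| * opnorm psi.
Proof.
move=> dp dq; apply: opnorm_le; first exact: dualD.
  move=> v; apply: le_trans (ler_normD _ _) _; rewrite mulrDl normrM -mulrA.
  by apply: lerD; [|apply: ler_wpM2l => //]; exact: opnorm_bound.
by rewrite addr_ge0 ?mulr_ge0 ?opnorm_ge0.
Qed.

Lemma opnormZ phi a : dual N phi -> opnorm (fun v => a * phi v) = `|a| * opnorm phi.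
Proof.
have le b psi : dual N psi -> opnorm (fun v => b * psi v) <= `|b| * opnorm psi.
  move=> dq; apply: opnorm_le; first exact: dualZ; last by rewrite mulr_ge0 ?opnorm_ge0.
  by move=> v; rewrite normrM -mulrA ler_wpM2l // opnorm_bound.
move=> dp; apply/eqP; rewrite eq_le le //=; have [->|a0] := eqVneq a 0.
  by rewrite normr0 mul0r opnorm_ge0 //; exact: dualZ.
have := le a^-1 _ (dualZ a dp); rewrite normfV mulrC ler_pdivlMr ?normr_gt0 // mulrC.
by congr (_ * opnorm _ <= _); apply/funext => v; rewrite mulrA mulVf // mul1r.
Qed.

Lemma dual_sphereP phi : dual_sphere N phi <-> dual N phi /\ opnorm phi = 1.
Proof.
split=> -[dp]; first by rewrite dual_normE // => -[].
by move=> p1; split=> //; rewrite dual_normE // p1.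
Qed.

Lemma dual_sphere_normalize phi : dual N phi -> opnorm phi != 0 ->
  dual_sphere N (fun v => (opnorm phi)^-1 * phi v).
Proof.
move=> dp p0; apply/dual_sphereP; split; first exact: dualZ.
by rewrite opnormZ // normfV ger0_norm ?opnorm_ge0 // mulVf.
Qed.

(** A functional which is small on finitely many vectors differs from one vanishing
    there by a functional of small norm, namely its composition with a bounded
    projection onto the span of these vectors.  The projection is built one vector
    at a time, with functionals norming the new direction. *)
Lemma finite_rank_retraction (es : seq V) : exists P : V -> V,
  [/\ forall a u v, P (a *: u + v) = a *: P u + P v,
      exists2 k, 0 <= k & forall v, N (P v) <= k * N v,
      {in es, forall e, P e = e}
    & forall eta, 0 < eta -> exists2 kappa, 0 < kappa &
        forall w, scalar w -> {in es, forall e, `|w e| <= kappa} ->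
        forall v, `|w (P v)| <= eta * N v].
Proof.
have [_ ND NZ] := hN.
elim: es => [|e es [P [linP [k k0 Pk] Pes Psmall]]].
  exists (fun=> 0); split=> //.
  - by move=> a u v; rewrite scaler0 addr0.
  - by exists 0 => // v; rewrite is_norm0 mul0r.
  - move=> eta eta0; exists 1 => // w sw _ v.
    by rewrite scalar_0 // normr0 mulr_ge0 ?is_norm_ge0 // ltW.
have [eE|e'0] := eqVneq (P e) e.
  exists P; split=> //; first by exists k.
    by move=> x; rewrite inE => /predU1P[-> //|]; exact: Pes.
  move=> eta eta0; have [kappa kappa0 small] := Psmall eta eta0.
  exists kappa => // w sw wes; apply: small => // x xes.
  by apply: wes; rewrite inE xes orbT.
pose e' := e - P e.
have Ne' : 0 < N e' by apply: is_norm_gt0; rewrite subr_eq0 eq_sym.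
have [chi [schi chiN chie']] := exists_norming e'.
pose psi v := (N e')^-1 * chi (v - P v).
have psiL a u v : psi (a *: u + v) = a * psi u + psi v.
  rewrite /psi linP opprD addrACA -scalerBr schi; ring.
pose K := (N e')^-1 * (1 + k).
have K0 : 0 <= K by rewrite mulr_ge0 ?addr_ge0 // invr_ge0 ltW.
have psiK v : `|psi v| <= K * N v.
  rewrite normrM gtr0_norm ?invr_gt0 // -mulrA ler_wpM2l ?invr_ge0 ?(ltW Ne') //.
  apply: le_trans (chiN _) _; apply: le_trans (ND _ _) _.
  by rewrite is_normN mulrDl mul1r lerD2l.
have psi_es x : x \in es -> psi x = 0.
  by move=> xes; rewrite /psi Pes // subrr scalar_0 // mulr0.
have psi_e : psi e = 1 by rewrite /psi -/e' chie' mulVf // gt_eqF.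
exists (fun v => P v + psi v *: e'); split.
- move=> a u v; rewrite linP psiL scalerDl (scalerDr a) scalerA -!addrA; congr (_ + _).
  by rewrite addrCA.
- exists (k + K * N e'); first by rewrite addr_ge0 // mulr_ge0 // ltW.
  move=> v; apply: le_trans (ND _ _) _; rewrite NZ mulrDl lerD //.
  by rewrite mulrAC ler_wpM2r // ltW.
- move=> x; rewrite inE => /predU1P[->|xes].
    by rewrite psi_e scale1r /e' addrC subrK.
  by rewrite psi_es // scale0r addr0 Pes.
move=> eta eta0; pose Q := 1 + K * (1 + N e).
have Q0 : 0 < Q by rewrite ltr_pwDl // mulr_ge0 // addr_ge0 ?is_norm_ge0.
have [kappa kappa0 small] := Psmall (eta / Q) (divr_gt0 eta0 Q0).
exists (Num.min kappa (eta / Q)); first by rewrite lt_min kappa0 divr_gt0.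
move=> w sw wes v.
have wP u : `|w (P u)| <= eta / Q * N u.
  apply: small => // x xes; have := wes x; rewrite inE xes orbT => /(_ isT).
  by rewrite le_min => /andP[].
have we : `|w e| <= eta / Q.
  by have := wes e; rewrite inE eqxx => /(_ isT); rewrite le_min => /andP[].
rewrite scalar_add // scalar_scale // (le_trans (ler_normD _ _)) // normrM.
have we' : `|w e'| <= eta / Q * (1 + N e).
  rewrite scalar_sub // (le_trans (ler_normB _ _)) // mulrDr mulr1 lerD //.
have -> : eta * N v = eta / Q * N v + (K * N v) * (eta / Q * (1 + N e)).
  rewrite (_ : _ + _ = eta / Q * Q * N v); first by rewrite divfK // gt_eqF.
  by rewrite /Q; ring.
by rewrite lerD // ler_pM.
Qed.

End Norm.

(** * From the dual modulus to smoothness of the norm *)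

Section Smoothness.
Variables (R : realType) (V : lmodType R) (N : V -> R).
Hypothesis hN : is_norm N.
Implicit Types (phi psi : V -> R) (u v : V).

Lemma theta_gtP (zs : V -> R) (tau beta : R) : tau != 0 ->
  (beta%:E < theta N tau)%E -> dual_sphere N zs ->
  exists n (e : 'I_n -> V), forall ws, dual_sphere N ws -> (forall i, ws (e i) = 0) ->
    1 + beta < opnorm N (fun v => zs v + tau * ws v).
Proof.
move=> tau0 + Szs; rewrite /theta (negbTE tau0) => theta_gt.
have : (beta%:E < theta_at N zs tau)%E.
  by apply: lt_le_trans theta_gt _; apply: ereal_inf_lbound; exists zs.
move/ereal_sup_gt => [_ [E [n [e EE]] <-]] inf_gt; exists n, e => ws Sws wse.
have [dz _] := Szs; have [dw _] := Sws; have [sw _] := dw.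
have dzw := dualD hN tau dz dw.
have /(lt_le_trans inf_gt) : (ereal_inf [set (dual_norm N (fun v => zs v + tau * ws v)%R - 1)%E
           | ws in dual_sphere N `&` annihilator N E] <=
     dual_norm N (fun v => zs v + tau * ws v)%R - 1)%E.
  apply: ereal_inf_lbound; exists ws => //; split=> //; split=> // v; rewrite EE => -[c ->].
  rewrite (scalar_sum _ _ sw) big1 // => i _.
  by rewrite scalar_scale // wse mulr0.
by rewrite dual_normE // lte_fin; lra.
Qed.

(** The estimate for functionals [u] that are weak* close to a given [u0].  Write
    [u = u0 + w + e] with [w] in the annihilator supplied by the modulus and [e] of
    small norm.  For [z] in the kernel of [u0], [u (v + z)] is at most
    [r |v| + |w| |z|] up to small terms, where [r] is the norm of [u0].  By
    convexity in the length of [w], the lower bound [1 + beta] at length [tau] gives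
    [r + (beta / tau) |w| <= |u0 + w|] beyond length [r tau], and below that length
    [r + (beta / tau) |w| <= r (1 + beta)]. *)
Lemma smoothness_near (tau beta delta : R) v (u0 : V -> R) :
  0 < tau -> 0 <= beta -> (beta%:E < theta N tau)%E -> 0 < delta -> v != 0 ->
  scalar u0 -> (forall x, `|u0 x| <= N x) ->
  exists eta (es : seq V) kappa, [/\ 0 < eta, 0 < kappa &
    forall u : V -> R, scalar u -> (forall x, `|u x| <= N x) ->
      (forall e, e \in es -> `|u e - u0 e| <= kappa) ->
    forall z, `|u0 z| <= eta -> N z <= beta / tau * N v ->
      u (v + z) <= (1 + beta + delta) * N v].
Proof.
move=> tau0 beta0 theta_gt delta0 v0 su0 u0N.
have L0 := is_norm_gt0 hN v0.
set L := N v in L0 *; pose sigma := beta / tau.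
have sigma0 : 0 <= sigma by rewrite divr_ge0 // ltW.
have du0 : dual N u0 by split=> //; exists 1 => x; rewrite mul1r.
pose r := opnorm N u0; have r0 : 0 <= r by apply: opnorm_ge0.
have r1 : r <= 1 by apply: opnorm_le => // x; rewrite mul1r.
have [zs [Szs u0E]] : exists zs, dual_sphere N zs /\ forall x, u0 x = r * zs x.
  (* For [u0 = 0] any functional of norm one does. *)
  have [rE|rn0] := eqVneq r 0.
    have [chi [schi chiN chiv]] := exists_norming hN v.
    have dchi : dual N chi by split=> //; exists 1 => x; rewrite mul1r.
    exists chi; split; last first.
      move=> x; rewrite rE mul0r; apply/eqP; rewrite -normr_le0.
      by have := opnorm_bound hN x du0; rewrite -/r rE mul0r.
    apply/dual_sphereP => //; split=> //; apply/eqP; rewrite eq_le.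
    rewrite opnorm_le //=; last by move=> x; rewrite mul1r.
    have := opnorm_bound hN v dchi; rewrite chiv (gtr0_norm L0).
    by rewrite -[X in X <= _]mul1r ler_pM2r.
  exists (fun x => r^-1 * u0 x); split; first exact: dual_sphere_normalize.
  by move=> x; rewrite mulVKf.
have [n [e gt1]] := theta_gtP (lt0r_neq0 tau0) theta_gt Szs.
have [P [linP [k k0 Pk] Pe Psmall]] := finite_rank_retraction hN [seq e i | i : 'I_n].
pose D := L + 2 + sigma * L.
have D0 : 0 < D by have := mulr_ge0 sigma0 (ltW L0); rewrite /D; lra.
pose eta := delta * L / D; have eta0 : 0 < eta by rewrite divr_gt0 ?mulr_gt0.
have [kappa kappa0 small] := Psmall eta eta0.
exists eta, (v :: [seq e i | i : 'I_n]), (Num.min kappa eta); split=> //.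
  by rewrite lt_min kappa0.
move=> u su uN near_u z u0z Nz.
pose w0 x := u x - u0 x.
have du : dual N u by split=> //; exists 1 => x; rewrite mul1r.
have dw0 : dual N w0 by exact: dualB.
have [sw0 _] := dw0.
have w0P x : `|w0 (P x)| <= eta * N x.
  apply: small => // y ye; have := near_u y; rewrite inE ye orbT => /(_ isT).
  by rewrite le_min => /andP[].
have dw0P : dual N (fun x => w0 (P x)).
  split; last by exists eta.
  by move=> a x y; rewrite linP sw0.
pose w x := w0 x - w0 (P x).
have dw : dual N w by exact: dualB.
have we i : w (e i) = 0 by rewrite /w Pe ?subrr // map_f // mem_enum.
pose s := opnorm N w; have s0 : 0 <= s by exact: opnorm_ge0.
have key : r + sigma * s <= 1 + beta + eta.
  have [sE|sn0] := eqVneq s 0; first by rewrite sE mulr0; lra.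
  have sgt0 : 0 < s by rewrite lt0r sn0.
  have Sws := dual_sphere_normalize hN dw sn0.
  have ws0 i : s^-1 * w (e i) = 0 by rewrite we mulr0.
  have := gt1 _ Sws ws0; rewrite -/s.
  set h := fun x => _; move=> gt.
  have [srt|rts] := leP s (r * tau).
    have : sigma * s <= r * beta.
      by rewrite /sigma mulrAC ler_pdivrMr //; have := ler_wpM2l beta0 srt; lra.
    have : r * (1 + beta) <= 1 * (1 + beta) by rewrite ler_wpM2r // addr_ge0.
    lra.
  have [dzs zs1] := (dual_sphereP hN zs).1 Szs.
  have hE : (fun x => (s / tau) * h x) =
      (fun x => (u x - w0 (P x)) + (s / tau - r) * zs x).
    apply/funext => x; have -> : s / tau * h x = s / tau * zs x + w x.
      by rewrite /h; field; rewrite sn0 gt_eqF.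
    by rewrite /w /w0 [u0 x]u0E; ring.
  have dh : dual N h by apply: dualD => //; exact: dualZ.
  have st0 : 0 < s / tau by rewrite divr_gt0.
  have : opnorm N (fun x => (s / tau) * h x) <= (1 + eta) + (s / tau - r).
    rewrite hE; apply: le_trans (opnormD hN _ (dualB hN du dw0P) dzs) _.
    rewrite zs1 mulr1 ger0_norm; last by rewrite subr_ge0 ler_pdivlMr // ltW.
    rewrite lerD2r; apply: opnorm_le => //; first exact: dualB.
      move=> x; apply: le_trans (ler_normB _ _) _; rewrite mulrDl mul1r.
      by apply: lerD.
    by rewrite addr_ge0 // ltW.
  rewrite opnormZ // gtr0_norm //.
  have : s / tau * (1 + beta) < s / tau * opnorm N h by rewrite ltr_pM2l.
  have -> : s / tau * (1 + beta) = s / tau + sigma * s by rewrite /sigma; ring.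
  lra.
have uE : u (v + z) = u v + u0 z + w z + w0 (P z).
  by rewrite scalar_add // /w /w0; ring.
have uv : u v <= r * L + eta.
  have := near_u v; rewrite inE eqxx => /(_ isT); rewrite le_min => /andP[_].
  have := opnorm_bound hN v du0; rewrite -/r -/L !ler_norml; lra.
have wz : w z <= s * (sigma * L).
  apply: le_trans (ler_norm _) _; apply: le_trans (opnorm_bound hN z dw) _.
  by rewrite ler_wpM2l.
have ez : w0 (P z) <= eta * (sigma * L).
  apply: le_trans (ler_norm _) _; apply: le_trans (w0P z) _.
  by rewrite ler_wpM2l // ltW.
have u0z' : u0 z <= eta by apply: le_trans (ler_norm _) _.
rewrite uE; have : eta * D = delta * L by rewrite /eta divfK ?gt_eqF.
have : (r + sigma * s) * L <= (1 + beta + eta) * L by rewrite ler_wpM2r // ltW.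
rewrite /D; lra.
Qed.

(** The weak neighbourhoods of 0.  They replace the subspaces of finite codimension,
    on which the smoothness estimate would hold as well: nearly vanishing
    functionals suffice, and are what an approximate fixed point argument gives. *)
Definition weak_nbhs0 : set_system V :=
  [set W | exists (ls : seq (V -> R)) (eta : R),
    [/\ 0 < eta, forall l, l \in ls -> dual N l
      & [set z | forall l, l \in ls -> `|l z| <= eta] `<=` W]].

Global Instance weak_nbhs0_filter : Filter weak_nbhs0.
Proof.
split.
- by exists [::], 1; split.
- move=> A B [ls [eta [eta0 dls lsA]]] [ms [nu [nu0 dms msB]]].
  exists (ls ++ ms), (Num.min eta nu); split; first by rewrite lt_min eta0.
    by move=> l; rewrite mem_cat => /orP[/dls|/dms].
  move=> z small; split; [apply: lsA|apply: msB] => l ll.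
    by have := small l; rewrite mem_cat ll => /(_ isT); rewrite le_min => /andP[].
  by have := small l; rewrite mem_cat ll orbT => /(_ isT); rewrite le_min => /andP[].
- move=> A B AB [ls [eta [eta0 dls lsA]]]; exists ls, eta; split=> //.
  exact: subset_trans AB.
Qed.

Lemma weak_nbhs0_le l eta : dual N l -> 0 < eta ->
  \forall z \near weak_nbhs0, `|l z| <= eta.
Proof.
move=> dl eta0; exists [:: l], eta; split=> // [m|z]; first by rewrite inE => /eqP ->.
by apply; rewrite inE.
Qed.

Let continuous_scalar_defect (T : topologicalType) (f g h : T -> R) (a : R) :
  continuous f -> continuous g -> continuous h -> continuous (fun t => f t - (a * g t + h t)).
Proof.
move=> cf cg ch u; exact: (cvgB (cf u) (cvgD (cvgM (cvg_cst a) (cg u)) (ch u))).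
Qed.

Let near_seq (T : topologicalType) (g : V -> T -> R) (t0 : T) (es : seq V) (kappa : R) :
  (forall e, continuous (g e)) -> 0 < kappa ->
  \forall t \near t0, forall e, e \in es -> `|g e t - g e t0| <= kappa.
Proof.
move=> cg kappa0; elim: es => [|e es IH]; first by apply: nearW => t e; rewrite in_nil.
have near_e : \forall t \near t0, `|g e t - g e t0| <= kappa.
  exact: (cvgr_distC_le _ _ (cg e t0) _ kappa0).
apply: filterS2 IH near_e => t near_t te x; rewrite inE => /predU1P[->//|].
exact: near_t.
Qed.

Let dual_ball : set {ptws V -> R} :=
  [set u | scalar (u : V -> R) /\ forall x, `|u x| <= N x].

Let eval_continuous x : continuous (fun u : {ptws V -> R} => u x).
Proof. exact: (@proj_continuous V (fun=> R) x). Qed.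

Lemma compact_dual_ball : compact dual_ball.
Proof.
have := @tychonoff V (fun=> R) (fun x => `[- N x, N x]%classic) (fun x => @segment_compact R _ _).
move=> cptB; apply: subclosed_compact cptB _; last first.
  by move=> u [_ uN] x /=; rewrite in_itv /= -ler_norml.
have -> : dual_ball =
    \bigcap_(p in [set: R * V * V])
      ((fun u : {ptws V -> R} => u (p.1.1 *: p.1.2 + p.2) - (p.1.1 * u p.1.2 + u p.2))
        @^-1` [set x | x = 0])
    `&` \bigcap_(x in [set: V]) ((fun u : {ptws V -> R} => `|u x|) @^-1` [set y | y <= N x]).
  apply/seteqP; split=> u [su uN]; split.
  - by move=> [[a x] y] _ /=; rewrite su subrr.
  - by move=> x _; exact: uN.
  - by move=> a x y; apply/eqP; rewrite -subr_eq0; apply/eqP; exact: (su (a, x, y)).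
  - by move=> x; exact: (uN x I).
apply: closedI; apply: closed_bigI => p _.
  apply: preimage_closed; last exact: closed_eq.
  by move=> u _; apply: continuous_scalar_defect; exact: eval_continuous.
apply: preimage_closed; last exact: closed_le.
move=> u _; apply: (@continuous_comp _ _ _ (fun u : {ptws V -> R} => u p) (@Num.norm R R)).
  exact: eval_continuous.
exact: norm_continuous.
Qed.

(** [smoothness_near] made uniform on the dual ball by compactness; then a functional
    norming [v + z] turns it into an estimate of the norm. *)
Theorem primal_smoothness (tau beta delta : R) v :
  0 < tau -> 0 <= beta -> (beta%:E < theta N tau)%E -> 0 < delta -> v != 0 ->
  \forall z \near weak_nbhs0, N z <= beta / tau * N v ->
    N (v + z) <= (1 + beta + delta) * N v.
Proof.
move=> tau0 beta0 theta_gt delta0 v0.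
pose P z (u : {ptws V -> R}) := N z <= beta / tau * N v -> u (v + z) <= (1 + beta + delta) * N v.
have : \forall z \near weak_nbhs0, dual_ball `<=` P z.
  have /compact_near_coveringP/near_covering_withinP := compact_dual_ball.
  apply => u0 [su0 u0N].
  have [eta [es [kappa [eta0 kappa0 sm]]]] := smoothness_near tau0 beta0 theta_gt delta0 v0 su0 u0N.
  exists ([set u : {ptws V -> R} | forall e, e \in es -> `|u e - u0 e| <= kappa],
          [set z | `|u0 z| <= eta]).
    split=> /=; last first.
      by apply: weak_nbhs0_le => //; split=> //; exists 1 => x; rewrite mul1r.
    exact: near_seq eval_continuous kappa0.
  by move=> [u z] [/= near_u near_z] [su uN] Nz; exact: (sm u su uN near_u z near_z Nz).
apply: filterS => z /= ball_le Nz.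
have [u [su uN <-]] := exists_norming hN (v + z).
exact: (ball_le u).
Qed.

End Smoothness.

(** * The Gorelik principle *)

(** The image of a bounded set in a finite-dimensional space is totally bounded;
    the point is that the net is taken inside the set itself. *)
Lemma finite_net (R : realType) (T : eqType) (ls : seq (T -> R)) (D : set T) (eta : R) :
  0 < eta -> (forall l : T -> R, l \in ls -> exists C : R, forall u, D u -> `|l u| <= C) ->
  exists xs : seq T, (forall x, x \in xs -> D x) /\
    forall u, D u -> exists2 x, x \in xs & forall l, l \in ls -> `|l u - l x| <= eta.
Proof.
move=> eta0; elim: ls D => [|l ls IH] D bnd.
  have [[x Dx]|D0] := pselect (D !=set0).
    exists [:: x]; split=> [y|u Du]; first by rewrite inE => /eqP ->.
    by exists x => //; rewrite inE.
  by exists [::]; split=> // u Du; case: D0; exists u.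
have [C lC] := bnd l (mem_head _ _).
pose piece j := [set u | D u /\ eta * j%:R <= l u + C <= eta * j.+1%:R].
have /choice[xs xsP] : forall j, exists xs : seq T, (forall x, x \in xs -> piece j x) /\
    forall u, piece j u -> exists2 x, x \in xs & forall l, l \in ls -> `|l u - l x| <= eta.
  move=> j; apply: IH => m mls; have [|C' mC'] := bnd m; first by rewrite inE mls orbT.
  by exists C' => u [Du _]; exact: mC'.
pose q := (Num.truncn ((C + C) / eta)).+1.
exists (flatten [seq xs j | j <- iota 0 q]); split.
  move=> x /flatten_mapP[j _ xj]; have [/(_ x xj)[]//] := xsP j.
move=> u Du; have := lC u Du; rewrite ler_norml => /andP[lo hi].
have ge0 : 0 <= (l u + C) / eta by rewrite divr_ge0 ?(ltW eta0) //; lra.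
pose j := Num.truncn ((l u + C) / eta).
have pu : piece j u.
  have /andP[jle jlt] := truncn_itv ge0; split=> //.
  move: jle jlt; rewrite -/j ler_pdivlMr // ltr_pdivrMr // => jle /ltW jlt.
  by rewrite ![eta * _]mulrC jle.
have [pieceP /(_ u pu)[x xj xls]] := xsP j.
exists x.
  apply/flatten_mapP; exists j => //; rewrite mem_iota /= add0n ltnS.
  by apply: le_truncn; rewrite ler_pM2r ?invr_gt0 //; lra.
move=> m; rewrite inE => /predU1P[->|]; last exact: xls.
have [_ /andP[lo' hi']] := pieceP _ xj; have [_ /andP[lo'' hi'']] := pu.
move: hi' hi''; rewrite -natr1 mulrDr mulr1 => hi' hi''.
rewrite ler_norml; lra.
Qed.

Section Gorelik.
Variables (R : realType) (X : normedModType R).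

Lemma is_norm_normr : is_norm (fun x : X => `|x|).
Proof. by split=> [v /normr0_eq0//|u v|a v]; [exact: ler_normD|exact: normrZ]. Qed.

Lemma dual_continuous (l : X -> R) : dual (fun x => `|x|) l -> continuous l.
Proof.
move=> dl; have [sl _] := dl; pose k := opnorm (fun x : X => `|x|) l.
have k0 : 0 <= k by apply: opnorm_ge0 => //; exact: is_norm_normr.
have k1 : 0 < k + 1 by lra.
move=> x; apply/cvgrPdist_lt => e e0; near=> y.
rewrite -scalar_sub //; apply: le_lt_trans (opnorm_bound is_norm_normr _ dl) _.
apply: (@le_lt_trans _ _ ((k + 1) * `|x - y|)); first by rewrite ler_wpM2r // lerDl.
rewrite mulrC -ltr_pdivlMr //; near: y.
by apply/nbhs_normP; exists (e / (k + 1)) => //=; exact: divr_gt0.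
Unshelve. all: by end_near. Qed.

Definition comb n (x : 'I_n -> X) (v : 'rV[R]_n) : X := \sum_i v ord0 i *: x i.

Lemma comb_continuous n (x : 'I_n -> X) : continuous (comb x).
Proof.
apply: continuous_sum => i v; have c : continuous (fun u : 'rV[R]_n => u ord0 i).
  exact: coord_continuous.
apply: (@continuous_comp _ _ _ (fun u : 'rV[R]_n => u ord0 i) (fun k : R => k *: x i)).
  exact: c.
exact: scalel_continuous.
Qed.

Lemma norm_comb_le n (x : 'I_n -> X) v r :
  (forall i, `|x i| <= r) -> simplex v -> `|comb x v| <= r.
Proof.
move=> xr [v0 v1]; apply: le_trans (ler_norm_sum _ _ _) _.
rewrite -[r]mul1r -v1 mulr_suml; apply: ler_sum => i _.
by rewrite normrZ ger0_norm // ler_wpM2l.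
Qed.

(** The displacement [d v] from [phi (comb x v)] to [comb x v] is a point of the ball
    of radius [r], hence weakly close to some [x i].  [F i] measures this closeness,
    and a fixed point [v] is a barycentre of vertices which are all close to [d v].
    So [comb x v] is weakly close to [d v], that is, [phi (comb x v)] is weakly small. *)
Theorem gorelik (W : set X) (r : R) : 0 <= r -> weak_nbhs0 (fun x => `|x|) W ->
  exists n (x : 'I_n -> X), (forall i, `|x i| <= r) /\
    forall phi : X -> X, continuous phi ->
      (forall v, simplex v -> `|phi (comb x v) - comb x v| <= r) ->
      exists2 v, simplex v & W (phi (comb x v)).
Proof.
move=> r0 [ls [eta [eta0 dls lsW]]].
have half0 : 0 < eta / 2 by lra.
have [|xs [xs_r net]] := @finite_net _ X ls [set u | `|u| <= r] (eta / 2) half0.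
  move=> l /dls dl; exists (opnorm (fun x => `|x|) l * r) => u /= ur.
  apply: le_trans (opnorm_bound is_norm_normr _ dl) _.
  by rewrite ler_wpM2l // opnorm_ge0 //; exact: is_norm_normr.
exists (size xs), (fun i => xs`_i); split; first by move=> i; apply: xs_r; exact: mem_nth.
set x := fun i : 'I_(size xs) => xs`_i.
move=> phi cphi phi_r.
pose d (v : 'rV[R]_(size xs)) := comb x v - phi (comb x v).
have cd : continuous d.
  move=> v; apply: continuousB; first exact: comb_continuous.
  by apply: continuous_comp; [exact: comb_continuous|exact: cphi].
pose F i v := \prod_(l <- ls) Num.max 0 (eta - `|l (d v) - l (x i)|).
have F0 i v : 0 <= F i v by apply: prodr_ge0 => l _; rewrite le_max lexx.
have size0 : (0 < size xs)%N.
  have [|y + _] := net 0; first by rewrite /= normr0.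
  by rewrite -index_mem; exact: leq_ltn_trans.
have phi_r' v : simplex v -> `|d v| <= r by move=> sv; rewrite distrC phi_r.
have cF i : continuous (F i).
  rewrite /F; move: dls {net lsW F0 F}; elim: ls => [|l ls' IH] dls.
    by under eq_fun do rewrite big_nil; exact: cst_continuous.
  under eq_fun do rewrite big_cons.
  move=> v; have c0 : {for v, continuous (fun v =>
      \prod_(l <- ls') Num.max 0 (eta - `|l (d v) - l (x i)|))}.
    by apply: IH => m mls; apply: dls; rewrite inE mls orbT.
  have cl : continuous l by apply: dual_continuous; apply: dls; rewrite mem_head.
  have c1 : {for v, continuous (fun v => l (d v))} by apply: continuous_comp; [exact: cd|exact: cl].
  have c2 : {for v, continuous (fun v => `|l (d v) - l (x i)|)}.
    exact: (cvg_norm (cvgB c1 (cvg_cst _))).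
  have c3 : {for v, continuous (fun v => eta - `|l (d v) - l (x i)|)}.
    exact: (cvgB (cvg_cst _) c2).
  have c4 : {for v, continuous (fun v => Num.max 0 (eta - `|l (d v) - l (x i)|))}.
    by apply: continuous_max; [exact: cst_continuous|exact: c3].
  exact: (cvgM c4 c0).
have [v sv fix_v] := simplex_fixpoint size0 cF (fun i v _ => F0 i v).
exists v => //; apply: lsW => l lls.
have [[sl _] [v0 v1]] := (dls l lls, sv).
have near i : v ord0 i * `|l (d v) - l (x i)| <= v ord0 i * eta.
  have [->|vi0] := eqVneq (v ord0 i) 0; first by rewrite !mul0r.
  have vi : 0 < v ord0 i by rewrite lt0r vi0 v0.
  rewrite ler_pM2l // leNgt; apply/negP => far.
  have Fi0 : F i v = 0.
    apply/eqP; rewrite prodf_seq_eq0; apply/hasP; exists l => //=.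
    by rewrite max_l // subr_le0 ltW.
  have [u /(nthP 0)[j jlt xj] uls] := net (d v) (phi_r' v sv).
  have Fj0 : 0 < F (Ordinal jlt) v.
    rewrite /F big_seq; apply: prodr_gt0 => m mls.
    by rewrite lt_max /x /= xj; have := uls m mls; lra.
  have : 0 < v ord0 i * \sum_j F j v.
    apply: mulr_gt0 => //; rewrite (bigD1 (Ordinal jlt)) //= ltr_pwDl //.
    by apply: sumr_ge0.
  by rewrite -fix_v Fi0 ltxx.
have -> : phi (comb x v) = comb x v - d v by rewrite /d opprB addrC subrK.
have lE : l (comb x v - d v) = \sum_i v ord0 i * (l (x i) - l (d v)).
  rewrite scalar_sub // /comb scalar_sum //.
  under eq_bigr do rewrite scalar_scale //.
  under [RHS]eq_bigr do rewrite mulrBr.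
  by rewrite sumrB -mulr_suml v1 mul1r.
rewrite lE; apply: le_trans (ler_norm_sum _ _ _) _.
rewrite -[eta]mul1r -v1 mulr_suml; apply: ler_sum => i _.
by rewrite normrM ger0_norm // distrC.
Qed.

End Gorelik.

(** * The new norm *)

Lemma Lip_oo_lt (R : realType) (X Y : normedModType R) (f : X -> Y) (c : R) :
  (Lip_oo f < c%:E)%E ->
  exists2 s, 0 < s & forall p q, s <= `|p - q| -> `|f p - f q| <= c * `|p - q|.
Proof.
move=> /ereal_inf_lt[_ [s /= s0 <-] Ls]; exists s => // p q spq.
have pq : 0 < `|p - q| by exact: lt_le_trans spq.
rewrite -ler_pdivrMr // -lee_fin; apply: le_trans (ltW Ls).
by apply: ereal_sup_ubound; exists (p, q).
Qed.

Lemma simplex_net (R : realType) (Y : normedModType R) (m : nat) (h : 'rV[R]_m -> Y) :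
  continuous h -> exists ys : seq Y,
    forall v, simplex v -> exists2 y, y \in ys & `|h v - y| <= 1.
Proof.
move=> ch; have := @compact_simplex R m; rewrite compact_cover.
move=> /(_ 'rV[R]_m setT (fun i => h @^-1` ball (h i) 1)).
case=> [i _|v _|D' _ cov].
- by apply: open_comp => [? _|]; [exact: ch|exact: ball_open].
- by exists v => //=; exact: ballxx.
exists [seq h i | i <- finmap.enum_fset D'] => v /cov[i /= iD'].
rewrite -ball_normE /= distrC => /ltW le; exists (h i) => //.
exact: map_f.
Qed.

Section Renorming.
Variables (R : realType) (X Y : normedModType R) (f : X -> Y) (g : Y -> X).
Variables (K s M s2 C : R) (n : nat).
Hypotheses (K0 : 0 < K) (s0 : 0 < s) (M0 : 0 < M) (s20 : 0 < s2) (C0 : 0 <= C)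
  (n_gt0 : (0 < n)%N).
Hypotheses (cf : continuous f) (cg : continuous g).
Hypothesis fK : forall p q, s <= `|p - q| -> `|f p - f q| <= K * `|p - q|.
Hypothesis gM : forall y z, s2 <= `|y - z| -> `|g y - g z| <= M * `|y - z|.
Hypothesis fgC : forall y, `|f (g y) - y| <= C.
Hypothesis gfC : forall x, `|g (f x) - x| <= C.

Let ndual := dual (fun y : Y => `|y|).

Definition slopes (d : R) : set Y :=
  [set y | exists p q, d <= `|p - q| /\ y = `|p - q|^-1 *: (f p - f q)].

Definition slope_norm (d : R) (phi : Y -> R) : R := sup [set phi y | y in slopes d].

Lemma slopesN d y : slopes d y -> slopes d (- y).
Proof.
by move=> [p [q [dpq ->]]]; exists q, p; rewrite distrC -scalerN opprB.
Qed.

Lemma slopes_le d y : s <= d -> slopes d y -> `|y| <= K.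
Proof.
move=> sd [p [q [dpq ->]]]; have pq : 0 < `|p - q| := lt_le_trans s0 (le_trans sd dpq).
rewrite normrZ gtr0_norm ?invr_gt0 // mulrC ler_pdivrMr //.
by apply: fK; exact: le_trans dpq.
Qed.

Lemma slope_ubound d phi (c : R) : s <= d -> 0 <= c -> (forall y, `|phi y| <= c * `|y|) ->
  ubound [set phi y | y in slopes d] (K * c).
Proof.
move=> sd c0 phic _ [y yd <-]; apply: le_trans (ler_norm _) _.
apply: le_trans (phic y) _; rewrite mulrC ler_wpM2r //; exact: slopes_le yd.
Qed.

Lemma slope_norm_le d phi (c : R) : s <= d -> 0 <= c -> (forall y, `|phi y| <= c * `|y|) ->
  slope_norm d phi <= K * c.
Proof.
move=> sd c0 phic; have [ne|/nonemptyPn E] := pselect ([set phi y | y in slopes d] !=set0).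
  by apply: ge_sup => //; exact: slope_ubound.
by rewrite /slope_norm E sup0 mulr_ge0 // ltW.
Qed.

Lemma slope_has_ubound d phi : s <= d -> ndual phi ->
  has_ubound [set phi y | y in slopes d].
Proof.
move=> sd dp; exists (K * opnorm (fun y : Y => `|y|) phi); apply: slope_ubound => //.
  by apply: opnorm_ge0 => //; exact: is_norm_normr.
by move=> y; apply: opnorm_bound => //; exact: is_norm_normr.
Qed.

Lemma slope_norm_ub d phi y : s <= d -> ndual phi -> slopes d y -> phi y <= slope_norm d phi.
Proof. by move=> sd dp yd; apply: ub_le_sup; [exact: slope_has_ubound|exists y]. Qed.

Lemma slope_norm_bound d phi p q : s <= d -> ndual phi -> d <= `|p - q| ->
  phi (f p - f q) <= slope_norm d phi * `|p - q|.
Proof.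
move=> sd dp dpq; have pq : 0 < `|p - q| := lt_le_trans s0 (le_trans sd dpq).
rewrite -ler_pdivrMr // mulrC -(scalar_scale _ _ dp.1).
by apply: slope_norm_ub => //; exists p, q.
Qed.

Lemma slope_norm_ge0 d phi : s <= d -> ndual phi -> 0 <= slope_norm d phi.
Proof.
move=> sd dp; have [[y yd]|/nonemptyPn E] := pselect (slopes d !=set0).
  have := slope_norm_ub sd dp yd; have := slope_norm_ub sd dp (slopesN yd).
  rewrite scalar_opp; [lra|exact: dp.1].
by rewrite /slope_norm E image_set0 sup0.
Qed.

Lemma slope_normZ_le d phi (c : R) : s <= d -> ndual phi -> 0 <= c ->
  slope_norm d (fun y => c * phi y) <= c * slope_norm d phi.
Proof.
move=> sd dp c0; have [[y yd]|/nonemptyPn E] := pselect (slopes d !=set0).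
  apply: ge_sup; first by exists (c * phi y), y.
  by move=> _ [z zd <-]; rewrite ler_wpM2l // slope_norm_ub.
by rewrite /slope_norm E !image_set0 sup0 mulr0.
Qed.

Lemma slope_norm_adherent d phi (e : R) : s <= d -> ndual phi -> slopes d !=set0 -> 0 < e ->
  exists p q, [/\ d <= `|p - q|, slopes d (`|p - q|^-1 *: (f p - f q))
    & (slope_norm d phi - e) * `|p - q| <= phi (f p - f q)].
Proof.
move=> sd dp [y yd] e0.
have hs : has_sup [set phi y | y in slopes d].
  by split; [exists (phi y), y|exact: slope_has_ubound].
have [_ [_ [p [q [dpq ->]]] <-] lt] := sup_adherent e0 hs.
have pq : 0 < `|p - q| := lt_le_trans s0 (le_trans sd dpq).
exists p, q; split=> //; first by exists p, q.
rewrite -ler_pdivlMr // mulrC -(scalar_scale _ _ dp.1); exact: ltW.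
Qed.

(** Close points are compared through a third point at distance [s] from one of them
    and further from the other. *)
Lemma coarse_lipschitz p q : `|f p - f q| <= K * (`|p - q| + 2 * s).
Proof.
have [->|pq] := eqVneq p q; first by rewrite !subrr !normr0 add0r !mulr_ge0 // ltW.
have pq0 : 0 < `|p - q| by rewrite normr_gt0 subr_eq0.
pose m := p + (s / `|p - q|) *: (p - q).
have mp : `|m - p| = s.
  by rewrite /m addrAC subrr add0r normrZ normrM normfV normr_id divfK ?gtr0_norm // gt_eqF.
have mq : `|m - q| = `|p - q| + s.
  have -> : m - q = (1 + s / `|p - q|) *: (p - q).
    by rewrite /m scalerDl scale1r addrAC.
  rewrite normrZ ger0_norm ?addr_ge0 ?divr_ge0 //; try exact: ltW.
  by rewrite mulrDl mul1r divfK // gt_eqF.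
have -> : f p - f q = (f m - f q) - (f m - f p) by rewrite opprB [RHS]addrC addrA subrK.
apply: le_trans (ler_normB _ _) _.
have := @fK m q; have := @fK m p; rewrite mp mq => /(_ (lexx _)) h1.
have : s <= `|p - q| + s by lra.
by move=> /[swap] /[apply] h2; lra.
Qed.

(** The images by [g] of two remote points are remote, because [f] brings them back
    near the original points. *)
Lemma far_pairs d (y : Y) : y != 0 -> exists2 T0, 0 < T0 & forall T, T0 <= T ->
  [/\ d <= `|g (T *: y) - g 0|, `|g (T *: y) - g 0| <= M * (T * `|y|)
    & `|f (g (T *: y)) - f (g 0) - T *: y| <= 2 * C].
Proof.
move=> y0; have ny : 0 < `|y| by rewrite normr_gt0.
move: (s20) (C0) (s0) => s2_gt0 C_ge0 s_gt0.
have Kd : 0 <= K * `|d| by rewrite mulr_ge0 // ltW.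
have Ks : 0 < K * s by rewrite mulr_gt0.
pose Q := s2 + K * (`|d| + 2 * s) + 2 * C.
have Q0 : 0 < Q by rewrite /Q; lra.
exists (Q / `|y|) => [|T]; first exact: divr_gt0.
rewrite ler_pdivrMr // => QT; have T0 : 0 <= T.
  by rewrite -(pmulr_lge0 _ ny); lra.
have nT : `|T *: y - 0| = T * `|y| by rewrite subr0 normrZ ger0_norm.
have bf : `|f (g (T *: y)) - f (g 0) - T *: y| <= 2 * C.
  have -> : f (g (T *: y)) - f (g 0) - T *: y = (f (g (T *: y)) - T *: y) - (f (g 0) - 0).
    by rewrite subr0 addrAC.
  by apply: le_trans (ler_normB _ _) _; have := fgC (T *: y); have := fgC 0; lra.
split=> //; last first.
  by rewrite -nT; apply: gM; rewrite nT; rewrite /Q in QT; lra.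
have lip := coarse_lipschitz (g (T *: y)) (g 0).
have low : T * `|y| - 2 * C <= `|f (g (T *: y)) - f (g 0)|.
  have := ler_normB (f (g (T *: y)) - f (g 0)) (f (g (T *: y)) - f (g 0) - T *: y).
  by rewrite opprB addrC subrK normrZ (ger0_norm T0); lra.
apply: le_trans (ler_norm d) _; rewrite -(ler_pM2l K0).
rewrite /Q in QT; lra.
Qed.

Lemma slopes_nonempty d (y : Y) : y != 0 -> slopes d !=set0.
Proof.
move=> /(far_pairs d)[T T0 /(_ T (lexx _))[dT _ _]].
by exists (`|g (T *: y) - g 0|^-1 *: (f (g (T *: y)) - f (g 0))), (g (T *: y)), (g 0).
Qed.

(** [y] is almost a multiple of the increment of [f] between the points [g (T *: y)]
    and [g 0], whose distance is at most [M T |y|]; the error disappears when [T]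
    tends to infinity. *)
Lemma slope_norm_ge d phi y : s <= d -> ndual phi -> `|phi y| <= M * slope_norm d phi * `|y|.
Proof.
move=> sd dp; suff le z : phi z <= M * slope_norm d phi * `|z|.
  by rewrite ler_norml le andbT lerNl -(scalar_opp _ dp.1) -normrN le.
have [->|z0] := eqVneq z 0; first by rewrite (scalar_0 dp.1) normr0 mulr0.
set a := slope_norm d phi; have a0 : 0 <= a by exact: (slope_norm_ge0).
rewrite leNgt; apply/negP; rewrite -subr_gt0; set gam := _ - _ => gam0.
pose o := opnorm (fun y : Y => `|y|) phi.
have o0 : 0 <= o by apply: opnorm_ge0 => //; exact: is_norm_normr.
have [T0 T00 far] := far_pairs d z0.
pose T := T0 + 2 * C * o / gam + 1.
have Q0 : 0 <= 2 * C * o / gam by rewrite divr_ge0 ?mulr_ge0 // ltW.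
have [dT MT fT] := far T ltac:(rewrite /T; lra).
have T1 : 0 <= T by rewrite /T; lra.
have up := slope_norm_bound sd dp dT.
have lo : T * phi z - o * (2 * C) <= phi (f (g (T *: z)) - f (g 0)).
  have := opnorm_bound (is_norm_normr Y) (f (g (T *: z)) - f (g 0) - T *: z) dp.
  rewrite -/o (scalar_sub _ _ dp.1) (scalar_scale _ _ dp.1) => /ler_normlP[+ _].
  have := ler_wpM2l o0 fT; lra.
have aM := ler_wpM2l a0 MT.
have : gam * T <= 2 * C * o.
  rewrite -/a in up; rewrite /gam; lra.
have e1 : gam * (2 * C * o / gam) = 2 * C * o by rewrite mulrC divfK // gt_eqF.
by rewrite /T !mulrDr e1 mulr1; have := mulr_gt0 gam0 T00; lra.
Qed.

(** The ratio 4 leaves room for two losses: half of [|p - q|] is used by [v], and the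
    functional norming [v] loses another half on [v + z] and [v - z]. *)
Definition level (k : nat) : R := 4 ^+ k * s.

Lemma level_ge k : s <= level k.
Proof. by apply: ler_peMl; [exact: ltW|apply: exprn_ege1; rewrite ler1n]. Qed.

Definition avg_slope (phi : Y -> R) : R :=
  n%:R^-1 * \sum_(k < n) slope_norm (level k) phi.

Definition new_norm (y : Y) : R :=
  sup [set `|phi y| | phi in [set phi | ndual phi /\ avg_slope phi <= 1]].

Let n0 : 0 < n%:R :> R. Proof. by rewrite ltr0n. Qed.

Lemma avg_slope_ge0 phi : ndual phi -> 0 <= avg_slope phi.
Proof.
move=> dp; apply: mulr_ge0; first by rewrite invr_ge0 ltW.
apply: sumr_ge0 => k _; apply: (slope_norm_ge0) => //; exact: level_ge.
Qed.

Lemma avg_slope_le phi c : 0 <= c -> (forall y, `|phi y| <= c * `|y|) ->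
  avg_slope phi <= K * c.
Proof.
move=> c0 phic; rewrite /avg_slope ler_pdivrMl //.
apply: le_trans (_ : \sum_(k < n) K * c <= _).
  by apply: ler_sum => k _; apply: (slope_norm_le) => //; exact: level_ge.
by rewrite sumr_const card_ord mulr_natl.
Qed.

Lemma avg_slope_ge phi y : ndual phi -> `|phi y| <= M * avg_slope phi * `|y|.
Proof.
move=> dp; have : \sum_(k < n) `|phi y| <= \sum_(k < n) M * slope_norm (level k) phi * `|y|.
  by apply: ler_sum => k _; apply: slope_norm_ge => //; exact: level_ge.
rewrite sumr_const card_ord -mulr_suml -mulr_sumr -mulr_natl => le.
by rewrite /avg_slope mulrCA -!mulrA ler_pdivlMl // mulrA.
Qed.

Lemma avg_slopeZ_le phi c : ndual phi -> 0 <= c ->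
  avg_slope (fun y => c * phi y) <= c * avg_slope phi.
Proof.
move=> dp c0; rewrite mulrCA ler_pM2l ?invr_gt0 // mulr_sumr; apply: ler_sum => k _.
by apply: (slope_normZ_le) => //; exact: level_ge.
Qed.

Lemma new_norm_has_sup y :
  has_sup [set `|phi y| | phi in [set phi | ndual phi /\ avg_slope phi <= 1]].
Proof.
split.
  exists `|0 : R|, (fun=> 0) => //; split.
    by split=> [a u v|]; [rewrite mulr0 addr0|exists 0 => v; rewrite normr0 mul0r].
  have := @avg_slope_le (fun=> 0) 0 (lexx _); rewrite mulr0 => h.
  by apply: le_trans (h _) _ => // v; rewrite normr0 mul0r.
exists (M * `|y|) => _ [phi [dp A1] <-]; apply: le_trans (avg_slope_ge y dp) _.
by rewrite ler_wpM2r // ler_piMr // ltW.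
Qed.

Lemma new_norm_ge phi y : ndual phi -> avg_slope phi <= 1 -> `|phi y| <= new_norm y.
Proof. by move=> dp A1; apply: ub_le_sup; [case: (new_norm_has_sup y)|exists phi]. Qed.

Lemma new_norm_le y c : (forall phi, ndual phi -> avg_slope phi <= 1 -> `|phi y| <= c) ->
  new_norm y <= c.
Proof.
move=> le; apply: ge_sup; first by case: (new_norm_has_sup y).
by move=> _ [phi [dp A1] <-]; exact: le.
Qed.

Lemma new_norm_upper y : new_norm y <= M * `|y|.
Proof.
apply: new_norm_le => phi dp A1; apply: le_trans (avg_slope_ge y dp) _.
by rewrite ler_wpM2r // ler_piMr // ltW.
Qed.

Lemma new_norm_lower y : K^-1 * `|y| <= new_norm y.
Proof.
have [phi [sp phiN phiy]] := exists_norming (is_norm_normr Y) y.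
have dp : ndual phi by split=> //; exists 1 => v; rewrite mul1r.
have := @new_norm_ge (fun v => K^-1 * phi v) y.
rewrite phiy ger0_norm ?mulr_ge0 ?invr_ge0 ?(ltW K0) //; apply.
  exact: (dualZ (is_norm_normr Y)).
apply: le_trans (avg_slopeZ_le dp _) _; first by rewrite invr_ge0 ltW.
rewrite mulrC ler_pdivrMr // mul1r -[leRHS]mulr1; apply: avg_slope_le => // v.
by rewrite mul1r.
Qed.

Lemma is_norm_new_norm : is_norm new_norm.
Proof.
split=> [v v0|u v|a v].
- apply/normr0_eq0/eqP; have := new_norm_lower v; rewrite v0 mulrC pmulr_lle0 ?invr_gt0 //.
  by rewrite normr_le0 => /eqP ->; rewrite normr0.
- apply: new_norm_le => phi dp A1; rewrite (scalar_add _ _ dp.1).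
  by apply: le_trans (ler_normD _ _) _; rewrite lerD // new_norm_ge.
- apply/eqP; rewrite eq_le; have le b w : new_norm (b *: w) <= `|b| * new_norm w.
    apply: new_norm_le => phi dp A1; rewrite (scalar_scale _ _ dp.1) normrM.
    by rewrite ler_wpM2l // new_norm_ge.
  rewrite le /=; have [->|a0] := eqVneq a 0.
    rewrite normr0 mul0r scale0r; have := new_norm_lower 0.
    by rewrite normr0 mulr0.
  have := le a^-1 (a *: v); rewrite scalerA mulVf // scale1r normfV.
  by rewrite mulrC ler_pdivlMr ?normr_gt0 // mulrC.
Qed.

Lemma dual_new_norm phi : dual new_norm phi <-> ndual phi.
Proof.
split=> -[sp [k phik]]; split=> //.
  exists (Num.max k 0 * M) => v; apply: le_trans (phik v) _; rewrite -mulrA.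
  have N0 := is_norm_ge0 is_norm_new_norm v.
  apply: (@le_trans _ _ (Num.max k 0 * new_norm v)).
    by rewrite ler_wpM2r // le_max lexx.
  by rewrite ler_wpM2l ?new_norm_upper // le_max lexx orbT.
exists (Num.max k 0 * K) => v; apply: le_trans (phik v) _; rewrite -mulrA.
apply: (@le_trans _ _ (Num.max k 0 * `|v|)).
  by rewrite ler_wpM2r // le_max lexx.
rewrite ler_wpM2l // ?le_max ?lexx ?orbT // -ler_pdivrMl //; exact: new_norm_lower.
Qed.

(** Averages of slopes lie in the unit ball of [new_norm], which gives one inequality;
    the other one is the definition of [new_norm] as a polar. *)
Lemma opnorm_new_norm phi : ndual phi -> opnorm new_norm phi = avg_slope phi.
Proof.
move=> dp; have dN := (dual_new_norm phi).2 dp; have A0 := avg_slope_ge0 dp.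
apply/eqP; rewrite eq_le; apply/andP; split.
  apply: opnorm_le => // [|v]; first exact: is_norm_new_norm.
  have [AE|An0] := eqVneq (avg_slope phi) 0.
    by have := avg_slope_ge v dp; rewrite AE mulr0 !mul0r.
  have A1 : 0 < avg_slope phi by rewrite lt0r An0.
  rewrite -ler_pdivrMl //; have := @new_norm_ge (fun v => (avg_slope phi)^-1 * phi v) v.
  rewrite normrM gtr0_norm ?invr_gt0 //; apply; first exact: (dualZ (is_norm_normr Y)).
  by apply: le_trans (avg_slopeZ_le dp _) _; rewrite ?invr_ge0 ?mulVf.
have [[y y0]|Y0] := pselect (exists y : Y, y != 0); last first.
  have -> : avg_slope phi = 0; last exact: (opnorm_ge0 is_norm_new_norm).
  apply/eqP; rewrite eq_le A0 andbT -(mulr0 K); apply: avg_slope_le => // v.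
  have -> : v = 0 by apply/eqP/negPn/negP => v0; apply: Y0; exists v.
  by rewrite (scalar_0 dp.1) !normr0 mulr0.
apply/ler_addgt0Pr => e e0.
have /choice[w wP] : forall k, exists w, slopes (level k) w /\
    slope_norm (level k) phi - e <= phi w.
  move=> k; have [p [q [dpq sl le]]] := slope_norm_adherent (level_ge k) dp
    (slopes_nonempty (level k) y0) e0.
  exists (`|p - q|^-1 *: (f p - f q)); split=> //.
  rewrite (scalar_scale _ _ dp.1) mulrC ler_pdivlMr //.
  exact: lt_le_trans s0 (le_trans (level_ge k) dpq).
pose W := n%:R^-1 *: \sum_(k < n) w k.
have W1 : new_norm W <= 1.
  apply: new_norm_le => psi dq A1; rewrite (scalar_scale _ _ dq.1) (scalar_sum _ _ dq.1).
  rewrite normrM gtr0_norm ?invr_gt0 //; apply: le_trans A1; rewrite ler_pM2l ?invr_gt0 //.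
  apply: le_trans (ler_norm_sum _ _ _) _; apply: ler_sum => k _; have [sl _] := wP k.
  rewrite ler_norml lerNl -(scalar_opp _ dq.1).
  by rewrite !(slope_norm_ub (level_ge k) dq) //; exact: slopesN.
have := opnorm_bound is_norm_new_norm W dN => /(le_trans (ler_norm _)) phiW.
have : avg_slope phi - e <= phi W.
  rewrite (scalar_scale _ _ dp.1) (scalar_sum _ _ dp.1).
  rewrite -[e](mulKf (lt0r_neq0 n0)) /avg_slope -mulrBr ler_pM2l ?invr_gt0 //.
  have -> : n%:R * e = \sum_(k < n) e by rewrite sumr_const card_ord mulr_natl.
  rewrite -sumrB; apply: ler_sum => k _.
  by have [_] := wP k.
have := ler_piMr (opnorm_ge0 is_norm_new_norm dN) W1; lra.
Qed.

(** * Gain at one scale, and average over the scales *)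

(** The point [z] is provided by the Gorelik principle for the radius
    [r = (beta / tau) |v| / 2], so that [z] has norm at most [(beta / tau) |v|].
    The vector [y] has norm [b = (r - C) / M]: this is how far the map
    [a |-> g (y + f (x0 + a)) - x0] may be from the identity. *)
Lemma level_estimate (tau beta delta d t : R) (phi : Y -> R) (p q : X) :
  0 < tau -> 0 <= beta -> (beta%:E < theta (fun x : X => `|x|%R) tau)%E -> 0 < delta ->
  s <= d -> 4 * d <= `|p - q| -> 0 <= t -> ndual phi ->
  M * s2 + C <= beta / tau * (`|p - q| / 4) ->
  exists F : seq Y, forall w, ndual w -> (forall y, y \in F -> w y = 0) ->
    (forall y, `|w y| <= M * `|y|) -> (exists2 y1, `|y1| = 1 & 3^-1 <= w y1) ->
  phi (f p - f q) +
      t * ((beta / tau * (`|p - q| / 4) - C) / M / 3 - M * (C + 1)) <=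
    (1 + beta + delta) * (`|p - q| / 2) *
      (slope_norm d (fun y => phi y + t * w y) + slope_norm d phi).
Proof.
move=> tau0 beta0 theta_gt delta0 sd dpq t0 dphi big.
pose v := 2^-1 *: (p - q); pose x0 := 2^-1 *: (p + q).
have half_half (x : X) : 2^-1 *: x + 2^-1 *: x = x.
  by rewrite -scalerDl (_ : 2^-1 + 2^-1 = 1) ?scale1r //; lra.
have pE : p = x0 + v.
  by rewrite /x0 /v -scalerDr addrACA subrr addr0 scalerDr half_half.
have qE : q = x0 - v.
  by rewrite /x0 /v -scalerBr opprB [q - p]addrC addrACA subrr add0r scalerDr half_half.
have Lpq : `|v| = `|p - q| / 2 by rewrite normrZ ger0_norm ?invr_ge0 // mulrC.
have d0 : 0 < d by exact: lt_le_trans sd.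
have v0 : v != 0 by rewrite -normr_gt0; lra.
set sigma := beta / tau in big *; have sigma0 : 0 <= sigma by rewrite divr_ge0 // ltW.
have hX := is_norm_normr X.
have [chi [schi chiN chiv]] := exists_norming hX v.
have dchi : dual (fun x : X => `|x|) chi by split=> //; exists 1 => x; rewrite mul1r.
have nearW : \forall z \near weak_nbhs0 (fun x : X => `|x|), `|z| <= sigma * `|v| ->
    [/\ `|v + z| <= (1 + beta + delta) * `|v|, `|v - z| <= (1 + beta + delta) * `|v|,
        d <= `|v + z| & d <= `|v - z|].
  have vN0 : - v != 0 by rewrite oppr_eq0.
  have h1 := primal_smoothness hX tau0 beta0 theta_gt delta0 v0.
  have h2 := primal_smoothness hX tau0 beta0 theta_gt delta0 vN0.
  have h3 : \forall z \near weak_nbhs0 (fun x : X => `|x|), `|chi z| <= `|v| / 2.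
    by apply: weak_nbhs0_le => //; rewrite divr_gt0 // normr_gt0.
  apply: filterS3 h1 h2 h3 => z; rewrite normrN => h1 h2 h3 zs.
  have := h3; rewrite ler_norml => /andP[h31 h32].
  have := chiN (v + z); have := chiN (v - z).
  rewrite (scalar_sub _ _ schi) (scalar_add _ _ schi) chiv !ler_norml.
  move=> /andP[_ c1] /andP[_ c2].
  split; [exact: h1| |lra|lra].
  by rewrite distrC addrC; exact: h2.
pose r := sigma * (`|p - q| / 4); have rbig : M * s2 + C <= r by [].
have r0 : 0 <= r by rewrite mulr_ge0 // divr_ge0.
have [m [x [xr gor]]] := gorelik r0 nearW.
have cfx : continuous (fun u : 'rV[R]_m => f (x0 + comb x u)).
  move=> u; apply: (@continuous_comp _ _ _ (fun u => x0 + comb x u) f); last exact: cf.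
  apply: (@continuousD _ _ _ (fun=> x0) (comb x)); first exact: cst_continuous.
  exact: comb_continuous.
have [ys net] := simplex_net cfx.
exists (f p :: ys) => w dw wF wM [y1 y11 wy1].
pose b := (r - C) / M; have b0 : 0 <= b.
  by rewrite divr_ge0 ?(ltW M0) //; have := mulr_ge0 (ltW M0) (ltW s20); lra.
have bs2 : s2 <= b by rewrite ler_pdivlMr //; lra.
pose y := - (b *: y1).
have ny : `|y| = b by rewrite normrN normrZ y11 mulr1 ger0_norm.
(* [f (x0 + phi_ a)] is at distance at most [C] from [y + f (x0 + a)]. *)
pose phi_ a := g (y + f (x0 + a)) - x0.
have phi_close u : simplex u -> `|phi_ (comb x u) - comb x u| <= r.
  move=> su; set a := comb x u; have -> : phi_ a - a =
      (g (y + f (x0 + a)) - g (f (x0 + a))) + (g (f (x0 + a)) - (x0 + a)).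
    by rewrite addrA subrK opprD addrA.
  apply: le_trans (ler_normD _ _) _.
  have e1 : `|y + f (x0 + a) - f (x0 + a)| = b by rewrite addrK.
  have := @gM (y + f (x0 + a)) (f (x0 + a)); rewrite e1 => /(_ bs2).
  have := gfC (x0 + a); have : M * b = r - C by rewrite /b mulrC divfK // gt_eqF.
  lra.
have [||u su Wz] := gor phi_.
- move=> a; apply: (@continuousB _ _ _ (fun a => g (y + f (x0 + a))) (fun=> x0));
    last exact: cst_continuous.
  apply: (@continuous_comp _ _ _ (fun a => y + f (x0 + a)) g); last exact: cg.
  apply: (@continuousD _ _ _ (fun=> y) (fun a => f (x0 + a))); first exact: cst_continuous.
  apply: (@continuous_comp _ _ _ (fun a => x0 + a) f); last exact: cf.
  by apply: (@continuousD _ _ _ (fun=> x0) id); [exact: cst_continuous|].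
- exact: phi_close.
set a := comb x u in Wz *; set z := phi_ a in Wz *.
have za : `|z - a| <= r by exact: phi_close.
have ar : `|a| <= r by exact: norm_comb_le.
have zs : `|z| <= sigma * `|v|.
  have -> : z = (z - a) + a by rewrite subrK.
  by apply: le_trans (ler_normD _ _) _; rewrite Lpq; rewrite /r in za ar; lra.
have [vzp vzm dp_ dm] := Wz zs.
have x0z : x0 + z = g (y + f (x0 + a)) by rewrite /z /phi_ addrC subrK.
have fz : `|f (x0 + z) - (y + f (x0 + a))| <= C by rewrite x0z.
have [y' y'ys hy'] := net u su.
have wfa : w (f (x0 + a)) <= M.
  have -> : f (x0 + a) = (f (x0 + a) - y') + y' by rewrite subrK.
  rewrite (scalar_add _ _ dw.1) (wF y') ?inE ?y'ys ?orbT // addr0.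
  apply: le_trans (ler_norm _) _; apply: le_trans (wM _) _.
  by rewrite -[leRHS]mulr1 ler_pM2l.
have wfz : w (f (x0 + z)) <= - (b / 3) + M + M * C.
  have wy : w y = - (b * w y1) by rewrite /y (scalar_opp _ dw.1) (scalar_scale _ _ dw.1).
  set e := f (x0 + z) - (y + f (x0 + a)) in fz.
  have -> : f (x0 + z) = e + (y + f (x0 + a)) by rewrite subrK.
  rewrite (scalar_add _ (y + _) dw.1) (scalar_add y _ dw.1) wy.
  have := wM e; rewrite ler_norml => /andP[_].
  have := ler_wpM2l (ltW M0) fz; have := ler_wpM2l b0 wy1.
  lra.
have wfp : w (f p) = 0 by apply: wF; rewrite mem_head.
have dphiw : ndual (fun y => phi y + t * w y) by exact: (dualD (is_norm_normr Y)).
have pz : p - (x0 + z) = v - z by rewrite pE opprD addrACA subrr add0r.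
have zq : x0 + z - q = v + z by rewrite qE opprB addrC addrA subrK.
have up1 := slope_norm_bound (p := p) (q := x0 + z) sd dphiw.
have up2 := slope_norm_bound (p := x0 + z) (q := q) sd dphi.
rewrite pz in up1; rewrite zq in up2.
have {}up1 := up1 dm; have {}up2 := up2 dp_.
have A1 := ler_wpM2l (slope_norm_ge0 sd dphiw) vzm.
have A2 := ler_wpM2l (slope_norm_ge0 sd dphi) vzp.
have tw := ler_wpM2l t0 wfz.
move: up1 up2; rewrite !(scalar_sub _ _ dphi.1) (scalar_sub _ _ dw.1) wfp -Lpq -/r -/b.
lra.
Qed.

Lemma level_estimate_normalized (tau beta delta t : R) (phi : Y -> R) (k : nat) :
  1 <= M ->
  0 < tau -> 0 <= beta -> (beta%:E < theta (fun x : X => `|x|%R) tau)%E -> 0 < delta ->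
  0 <= t <= 1 -> ndual phi -> (exists y : Y, y != 0) ->
  M * s2 + C <= beta / tau * s -> C + M * (C + 1) <= 2 * s * delta ->
  exists F : seq Y, forall w, ndual w -> (forall y, y \in F -> w y = 0) ->
    (forall y, `|w y| <= M * `|y|) -> (exists2 y1, `|y1| = 1 & 3^-1 <= w y1) ->
  2 * slope_norm (level k.+1) phi - 3 * delta + t * (beta / tau) / (6 * M) <=
    (1 + beta + delta) *
      (slope_norm (level k) (fun y => phi y + t * w y) + slope_norm (level k) phi).
Proof.
move=> M1 tau0 beta0 theta_gt delta0 /andP[t0 t1] dphi [y0 y0n] big small.
have lge := level_ge.
have sigma0 : 0 <= beta / tau by rewrite divr_ge0 // ltW.
have [p [q [dpq _ pq_le]]] := slope_norm_adherent (lge k.+1) dphi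
  (slopes_nonempty (level k.+1) y0n) delta0.
have lS : level k.+1 = 4 * level k by rewrite /level exprS mulrA.
have spq : s <= `|p - q| / 4 by have := lge k; lra.
have far : 4 * level k <= `|p - q| by rewrite -lS.
have big' : M * s2 + C <= beta / tau * (`|p - q| / 4).
  by apply: le_trans big _; apply: ler_wpM2l.
have [F FP] := level_estimate tau0 beta0 theta_gt delta0 (lge k) far t0 dphi big'.
exists F => w dw wF wM wy; have := FP w dw wF wM wy.
set L := `|p - q| in dpq pq_le spq *; set sigma := beta / tau in sigma0 *.
set a' := slope_norm _ (fun _ => _); set a := slope_norm (level k) phi.
set a1 := slope_norm (level k.+1) phi in pq_le *.
move=> main; have L0 : 0 < L / 2 by move: (s0) => ?; lra.
rewrite -(ler_pM2l L0).
have err : t * (C / M / 3 + M * (C + 1)) <= L / 2 * delta.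
  apply: le_trans (_ : 2 * s * delta <= _); last by rewrite ler_pM2r //; lra.
  apply: le_trans small; rewrite -[leRHS]mul1r; apply: ler_pM => //.
    by rewrite addr_ge0 ?divr_ge0 ?mulr_ge0 ?addr_ge0 ?(ltW M0).
  rewrite lerD2r -mulrA ler_piMr // -invfM invf_le1 ?mulr_gt0 //; lra.
have e1 : t * ((sigma * (L / 4) - C) / M / 3 - M * (C + 1)) =
    L / 2 * (t * sigma / (6 * M)) - t * (C / M / 3 + M * (C + 1)).
  by field; rewrite gt_eqF.
move: main; rewrite e1 => main; lra.
Qed.

Lemma unit_witness w : ndual w -> K <= 2 -> avg_slope w = 1 ->
  exists2 y1 : Y, `|y1| = 1 & 3^-1 <= w y1.
Proof.
move=> dw K2 w1; have [[y lt]|none] := pselect (exists y, 3^-1 * `|y| < `|w y|).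
  have y0 : 0 < `|y|.
    rewrite normr_gt0; apply: contraTneq lt => ->.
    by rewrite (scalar_0 dw.1) !normr0 mulr0 ltxx.
  pose y1 := (Num.sg (w y) / `|y|) *: y.
  have sg1 : `|Num.sg (w y)| = 1.
    rewrite normr_sg; case: eqP lt => // ->; rewrite normr0.
    by rewrite pmulr_rlt0 ?invr_gt0 // ltNge normr_ge0.
  exists y1; first by rewrite normrZ normrM sg1 mul1r normfV normr_id mulVf ?gt_eqF.
  rewrite (scalar_scale _ _ dw.1) mulrAC -normrEsg ler_pdivlMr //; exact: ltW.
have le y : `|w y| <= 3^-1 * `|y|.
  by rewrite leNgt; apply/negP => lt; apply: none; exists y.
have third : 0 <= 3^-1 :> R by rewrite invr_ge0.
have := avg_slope_le third le; rewrite w1; lra.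
Qed.

(** Summing over the scales, the terms [2 a (k + 1) - a k] add up to the sum of the
    [a k], up to boundary terms bounded independently of [n]. *)
Lemma average_estimate (tau beta delta t : R) (phi : Y -> R) :
  1 <= M -> K <= 2 ->
  0 < tau -> 0 <= beta -> (beta%:E < theta (fun x : X => `|x|%R) tau)%E -> 0 < delta ->
  0 <= t <= 1 -> ndual phi -> avg_slope phi = 1 ->
  M * s2 + C <= beta / tau * s -> C + M * (C + 1) <= 2 * s * delta ->
  exists F : seq Y, forall w, ndual w -> avg_slope w = 1 ->
    (forall y, y \in F -> w y = 0) ->
  2 - 4 * M / n%:R - 3 * delta + t * (beta / tau) / (6 * M) <=
    (1 + beta + delta) * (avg_slope (fun y => phi y + t * w y) + 1).
Proof.
move=> M1 K2 tau0 beta0 theta_gt delta0 t01 dphi phi1 big small.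
have yex : exists y : Y, y != 0.
  have [y1 ny1 _] := unit_witness dphi K2 phi1.
  by exists y1; rewrite -normr_gt0 ny1.
have /choice[F FP] := fun k => level_estimate_normalized k M1 tau0 beta0 theta_gt delta0
  t01 dphi yex big small.
exists (flatten [seq F k | k <- iota 0 n]) => w dw w1 wF.
have wy := unit_witness dw K2 w1.
have wM y : `|w y| <= M * `|y|.
  by have := avg_slope_ge y dw; rewrite w1 mulr1.
have nn : 0 < n%:R :> R by rewrite ltr0n.
have phiM y : `|phi y| <= M * `|y|.
  by have := avg_slope_ge y dphi; rewrite phi1 mulr1.
pose a k := slope_norm (level k) phi.
pose a' k := slope_norm (level k) (fun y => phi y + t * w y).
have each (k : 'I_n) : 2 * a k.+1 - 3 * delta + t * (beta / tau) / (6 * M) <=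
    (1 + beta + delta) * (a' k + a k).
  apply: (FP k w dw _ wM wy) => y yF; apply: wF; apply/flatten_mapP; exists (k : nat) => //.
  by rewrite mem_iota /=.
have : \sum_(k < n) (2 * a k.+1 - 3 * delta + t * (beta / tau) / (6 * M)) <=
    \sum_(k < n) (1 + beta + delta) * (a' k + a k) by apply: ler_sum => k _; exact: each.
have cst (c : R) : \sum_(k < n) c = n%:R * c by rewrite sumr_const card_ord mulr_natl.
rewrite -mulr_sumr !big_split /= -mulr_sumr !cst.
have shift : \sum_(k < n) a k.+1 = \sum_(k < n) a k + a n - a 0.
  have := @big_ord_recr _ _ +%R n (fun k : 'I_n.+1 => a k).
  rewrite big_ord_recl /= => e; rewrite -e [RHS]addrAC subrr add0r.
  by apply: eq_bigr => k _.
have an : 0 <= a n by apply: (slope_norm_ge0) => //; exact: level_ge.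
have a0 : a 0 <= 2 * M.
  apply: le_trans (slope_norm_le (level_ge 0) (ltW M0) phiM) _.
  by rewrite ler_pM2r.
rewrite shift; have e1 : \sum_(k < n) a k = n%:R.
  move: phi1; rewrite /avg_slope => /(congr1 (fun z => n%:R * z)).
  by rewrite mulVKf ?gt_eqF // mulr1.
have e2 : \sum_(k < n) a' k = n%:R * avg_slope (fun y => phi y + t * w y).
  by rewrite /avg_slope mulVKf // gt_eqF.
rewrite e1 e2 => main.
rewrite -(ler_pM2l nn).
have e3 : n%:R * (4 * M / n%:R) = 4 * M by rewrite mulrC divfK // gt_eqF.
rewrite !mulrDr mulrN e3; lra.
Qed.

End Renorming.

(** * Conclusion *)

Section ThetaLowerBounds.
Variables (R : realType) (V : lmodType R) (N : V -> R).

Lemma theta_at_ge (zs : V -> R) (t : R) (c : \bar R) (F : seq V) :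
  (forall ws, dual_sphere N ws -> (forall y, y \in F -> ws y = 0) ->
    (c <= dual_norm N (fun v => zs v + t * ws v)%R - 1)%E) ->
  (c <= theta_at N zs t)%E.
Proof.
move=> cle; pose e (i : 'I_(size F)) := F`_i.
pose E := [set v | exists c : 'I_(size F) -> R, v = \sum_(i < size F) c i *: e i].
apply: le_trans (_ : ereal_inf [set (dual_norm N (fun v => zs v + t * ws v)%R - 1)%E
           | ws in dual_sphere N `&` annihilator N E] <= _)%E.
  apply: le_ereal_inf_tmp => _ [ws [Sws [_ wsE]] <-]; apply: cle => // y yF.
  have iF : (index y F < size F)%N by rewrite index_mem.
  apply: wsE; exists (fun i => (i == Ordinal iF)%:R).
  rewrite (bigD1 (Ordinal iF)) //= eqxx scale1r big1 ?addr0 /e /= ?nth_index //.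
  by move=> i /negbTE ->; rewrite scale0r.
by apply: ereal_sup_ubound; exists E => //; exists (size F), e.
Qed.

Lemma theta_at_ge0 (zs : V -> R) (t delta : R) :
  dual_sphere N zs -> 0 < delta -> ((- delta)%:E <= theta_at N zs t)%E.
Proof.
move=> [dz z1] delta0; have : ((1 - delta)%:E < dual_norm N zs)%E by rewrite z1 lte_fin; lra.
move=> /ereal_sup_gt[_ [v /= v1 <-]]; rewrite lte_fin => zv.
apply: (@theta_at_ge _ _ _ [:: v]) => ws _ wsv.
have := dual_norm_ge (fun v => zs v + t * ws v) v1.
rewrite wsv ?mem_head // mulr0 addr0 => le.
rewrite leeBrDr // -EFinD; apply: le_trans le; rewrite lee_fin; lra.
Qed.

End ThetaLowerBounds.

Theorem theorem6p5 (R : realType) (X Y : completeNormedModType R) (M : R)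
    (hM : 1 < M) (f : X -> Y) (g : Y -> X)
    (cf : continuous f) (cg : continuous g)
    (Lf : (Lip_oo f <= 1)%E) (Lg : (Lip_oo g < M%:E)%E)
    (hfg : exists C : R, [/\ 0 <= C,
        forall x : X, `|(g \o f) x - x| <= C
      & forall y : Y, `|(f \o g) y - y| <= C]) :
  forall eps : R, 0 < eps < 1 ->
  exists N : Y -> R,
    [/\ is_norm N,
        equivalent_norms (fun y : Y => `|y|) N,
        forall y : Y, (1 + eps)^-1 * `|y| <= N y <= M * `|y|
      & forall t : R, 0 <= t <= 1 ->
          (theta (fun x : X => `|x|%R) (t / (48 * M ^+ 2))%R - eps%:E
             <= theta N t)%E].
Proof.
move=> eps /andP[eps0 eps1]; have [C [C0 gfC fgC]] := hfg.
have K0 : 0 < 1 + eps by lra.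
have M0 : 0 < M by lra.
have [|sf sf0 fsf] := @Lip_oo_lt _ _ _ f (1 + eps).
  by apply: le_lt_trans Lf _; rewrite lte_fin; lra.
have [s2 s20 gM] := Lip_oo_lt Lg.
(* The errors in [average_estimate] are [4 M / n] and [3 delta]; with the extra factor
   [delta] on the right-hand side they must add up to less than [eps]. *)
pose delta := eps / 12; have delta0 : 0 < delta by rewrite /delta; lra.
have Ms2 : 0 < M * s2 by rewrite mulr_gt0.
have MC : 0 <= M * (C + 1) by rewrite mulr_ge0 ?addr_ge0 // ltW.
(* Only [beta >= eps / 2] matters, and then [beta / tau >= eps]; so this choice of [s]
   makes the radii in [level_estimate] large enough uniformly in [t]. *)
pose s := sf + (M * s2 + C) / eps + (C + M * (C + 1)) / (2 * delta).
have q1 : 0 <= (M * s2 + C) / eps by rewrite divr_ge0 ?(ltW eps0) //; lra.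
have q2 : 0 <= (C + M * (C + 1)) / (2 * delta) by rewrite divr_ge0 //; lra.
have s0 : 0 < s by rewrite /s; lra.
have fK p q : s <= `|p - q| -> `|f p - f q| <= (1 + eps) * `|p - q|.
  by move=> spq; apply: fsf; apply: le_trans spq; rewrite /s; lra.
have small1 : M * s2 + C <= eps * s.
  by rewrite [leRHS]mulrC -ler_pdivrMr // /s; lra.
have small2 : C + M * (C + 1) <= 2 * s * delta.
  by rewrite [leRHS]mulrAC [leRHS]mulrC -ler_pdivrMr ?mulr_gt0 // /s; lra.
pose n := (Num.bound (8 * M / eps)).+1; have n_gt0 : (0 < n)%N by [].
have small3 : 4 * M / n%:R <= eps / 2.
  have n0 : 0 < n%:R :> R by rewrite ltr0n.
  have nbig : 8 * M / eps < n%:R.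
    apply: lt_le_trans (archi_boundP _) _; first by rewrite divr_ge0 ?mulr_ge0 // ltW.
    by rewrite ler_nat.
  rewrite ler_pdivrMr //; move: nbig; rewrite ltr_pdivrMr //; lra.
pose N := new_norm f s n; exists N.
have hN : is_norm N := is_norm_new_norm K0 s0 M0 s20 C0 n_gt0 fK gM fgC.
have Nlo y : (1 + eps)^-1 * `|y| <= N y := new_norm_lower K0 s0 M0 s20 C0 n_gt0 fK gM fgC y.
have Nup y : N y <= M * `|y| := new_norm_upper K0 s0 M0 s20 C0 n_gt0 fK gM fgC y.
have dualE := dual_new_norm K0 s0 M0 s20 C0 n_gt0 fK gM fgC.
have opE := opnorm_new_norm K0 s0 M0 s20 C0 n_gt0 fK gM fgC.
split=> //.
- by exists (1 + eps)^-1, M; split=> // [|y]; [rewrite invr_gt0|rewrite Nlo Nup].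
- by move=> y; rewrite Nlo Nup.
move=> t /andP[t0 t1]; have [->|tn0] := eqVneq t 0.
  by rewrite mul0r /theta eqxx add0e lee_fin; lra.
have tgt0 : 0 < t by rewrite lt0r tn0.
set tau := t / (48 * M ^+ 2).
have M2 : 0 < 48 * M ^+ 2 by rewrite mulr_gt0 // exprn_gt0.
have tau0 : 0 < tau by rewrite divr_gt0.
rewrite [leRHS]/theta (negbTE tn0); apply: le_ereal_inf_tmp => _ [zs Szs <-].
have [dz z1] := (dual_sphereP hN zs).1 Szs.
have dzY := (dualE zs).1 dz.
have key beta : eps / 2 <= beta -> beta <= 1 ->
    (beta%:E < theta (fun x : X => `|x|%R) tau)%E ->
    exists F : seq Y, forall ws, dual_sphere N ws -> (forall y, y \in F -> ws y = 0) ->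
      2 - 3 / 4 * eps + 8 * beta <=
        (1 + beta + delta) * (opnorm N (fun y => zs y + t * ws y) + 1).
  move=> beta_ge beta1 theta_gt; have beta0 : 0 <= beta by lra.
  have sig : beta / tau = 48 * M ^+ 2 * beta / t.
    by rewrite /tau; field; rewrite tn0 gt_eqF.
  have M21 : 1 <= M ^+ 2 by rewrite exprn_ege1 // ltW.
  have sig_ge : eps <= beta / tau.
    rewrite sig ler_pdivlMr //; apply: (@le_trans _ _ eps).
      by rewrite ler_piMr // ltW.
    have := ler_wpM2r beta0 M21; lra.
  have [] := @average_estimate _ _ _ f g _ s M s2 C n K0 s0 M0 s20 C0 n_gt0 cf cg fK gM fgC gfC
    tau beta delta t zs.
  - exact: ltW.
  - lra.
  - exact: tau0.
  - exact: beta0.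
  - exact: theta_gt.
  - exact: delta0.
  - by rewrite t0 t1.
  - exact: dzY.
  - by rewrite -opE.
  - by apply: le_trans small1 _; rewrite ler_wpM2r // ltW.
  - exact: small2.
  move=> F FP; exists F => ws Sws wsF; have [dw w1] := (dual_sphereP hN ws).1 Sws.
  have dwY := (dualE ws).1 dw.
  have := FP ws dwY; rewrite -opE // w1 -opE; last exact: (dualD (is_norm_normr Y)).
  move=> /(_ erefl wsF).
  have -> : t * (beta / tau) / (6 * M) = 8 * (M * beta).
    by rewrite sig; field; rewrite tn0 gt_eqF.
  have : beta <= M * beta by rewrite ler_peMl // ltW.
  by rewrite /delta; lra.
have [small|large] := leP (theta (fun x : X => `|x|%R) tau) (eps / 2)%:E.
  have half : 0 < eps / 2 by lra.
  apply: le_trans (theta_at_ge0 t Szs half).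
  rewrite leeBlDr // -EFinD; apply: le_trans small _; rewrite lee_fin; lra.
(* A modulus above 1 is incompatible with [tau <= 1] unless the infimum runs over an
   empty set.  Applying [key] with [beta = 1] shows that the corresponding set of
   functionals on [Y] is empty too. *)
have [le1|gt1] := leP (theta (fun x : X => `|x|%R) tau) 1%:E; last first.
  have [||F FP] := key 1 _ _ gt1; [lra|by []|].
  apply: (theta_at_ge (F := F)) => ws Sws wsF.
  have [dw w1] := (dual_sphereP hN ws).1 Sws.
  exfalso; have := FP ws Sws wsF; have := opnormD hN t dz dw.
  rewrite z1 w1 (ger0_norm t0) mulr1 => up.
  set o := opnorm N _ in up * => main.
  have : (1 + 1 + delta) * (o + 1) <= (1 + 1 + delta) * 3 by rewrite ler_wpM2l //; lra.
  move: main; rewrite /delta; lra.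
have thfin : theta (fun x : X => `|x|%R) tau \is a fin_num.
  by rewrite fin_real // (lt_trans _ large) ?ltNyr //= (le_lt_trans le1) ?ltry.
move: large le1 key; rewrite -(fineK thfin) lte_fin lee_fin.
set r := fine _ => large le1 key; apply/lee_addgt0Pr => e e0.
pose beta := Num.max (eps / 2) (r - e).
have beta_lt : beta < r by rewrite gt_max large /=; lra.
have beta_ge : eps / 2 <= beta by rewrite le_max lexx.
have beta_e : r - e <= beta by rewrite le_max lexx orbT.
have [||F FP] := key beta beta_ge; [lra|by rewrite lte_fin|].
rewrite -leeBlDr //; apply: (theta_at_ge (F := F)) => ws Sws wsF.
have [dw w1] := (dual_sphereP hN ws).1 Sws.
rewrite dual_normE //; last exact: (dualD hN).
rewrite -!EFinB lee_fin; have := FP ws Sws wsF; set o := opnorm N _ => main.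
rewrite leNgt; apply/negP => lt.
have : (1 + beta + delta) * (o + 1) <= (1 + beta + delta) * (2 + beta - eps).
  by rewrite ler_wpM2l //; lra.
have bb : beta * beta <= beta * 1 by rewrite ler_wpM2l //; lra.
have be : 0 <= beta * eps by rewrite mulr_ge0 //; lra.
have ee : 0 <= eps * eps by rewrite mulr_ge0 // ltW.
have beps : beta * eps <= 1 * eps by rewrite ler_wpM2r //; lra.
move: main; rewrite /delta; lra.
Qed.
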